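(* Let $q\ge 2$ be an integer and consider the finite-spin model with pair interaction matrix $(u_{k,\ell})_{k,\ell\in\mathbb Z_q}$, $u_{k,\ell}\ge 0$, $u_{k,k}=0$, on $\mathcal T^d$. Put $u=\min_{k\neq\ell}u_{k,\ell}$ and $U=\max_{k,\ell}u_{k,\ell}$. Let $d_{\max}\in\mathbb N_0$, $d_{\max}\le d$, and let $\mathcal G^0_q=\mathcal G^0_q(d_{\max},d)$ be the set of configurations $\omega^0\in\mathbb Z_q^V$ whose set of broken edges $D=\{\{v,w\}\in E:\omega^0_v\neq\omega^0_w\}$ satisfies $d_D\le d_{\max}$. Assume $$(d-1)u>d_{\max}(U+u).$$ Then there is a finite $\beta_0=\beta_0(d,q,u,U,d_{\max})>0$ such that for all $\beta\ge\beta_0$ there is a family of Gibbs measures $(\mu^{\omega^0}_\beta)_{\omega^0\in\mathcal G^0_q}$ at inverse temperature $\beta$ with: (1) $\omega^0\neq\tau^0$ implies $\mu^{\omega^0}_\beta\neq\mu^{\tau^0}_\beta$; (2) each $\mu^{\omega^0}_\beta$ is extremal in the set of all Gibbs measures; (3) there exist constants $c,C>0$ such that for every $v\in V$, $\mu^{\omega^0}_\beta(\sigma_v=\omega^0_v)\ge 1-Ce^{-c\beta}$.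
   Context: $\mathcal T^d=(V,E)$ is the Cayley tree of order $d\ge2$ (every vertex has $d+1$ neighbours). Spins take values in $\mathbb Z_q=\{0,\dots,q-1\}$, $\Omega=\mathbb Z_q^V$. The edge $\{i,j\}$ carries energy $\Phi(\omega_i,\omega_j)=u_{\omega_i,\omega_j}$ (if $u$ is not symmetric, a fixed orientation of each edge is used). For finite $\Lambda\subset V$, $H_\Lambda(\omega_\Lambda\tau_{\Lambda^c})=\sum_{\{i,j\}\in E,\{i,j\}\cap\Lambda\neq\emptyset}\Phi(\xi_i,\xi_j)$ with $\xi=\omega_\Lambda\tau_{\Lambda^c}$, the specification is $\gamma_\Lambda(\omega_\Lambda\mid\tau)=e^{-\beta H_\Lambda(\omega_\Lambda\tau_{\Lambda^c})}/Z_\Lambda^\tau$, and Gibbs measures are probability measures satisfying the DLR equations for this specification. This includes the $q$-state Potts model ($u_{k,\ell}=1$ for $k\ne\ell$). For $D\subset E$, $d_D(v)$ is the number of edges of $D$ incident to $v$ and $d_D=\max_v d_D(v)$. *)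

(* Defs.v *)
From HB Require Import structures.
From mathcomp Require Import all_boot all_order all_algebra.
From mathcomp Require Import all_classical all_reals all_analysis.


Unset Strict Implicit.
Unset Printing Implicit Defensive.

Import Order.TTheory GRing.Theory Num.Theory.
Local Open Scope classical_set_scope.
Local Open Scope ring_scope.

(** Spin values: Z_q (meaningful for q >= 2, where 'Z_q is Z/qZ).
    We use an alias so that we can equip it with a pointed structure
    (needed for the measurable structure on configurations). *)
Definition spin (q : nat) : Type := 'Z_q.
HB.instance Definition _ q := Choice.on (spin q).
HB.instance Definition _ q := Finite.on (spin q).
HB.instance Definition _ q := isPointed.Build (spin q) (0%R : 'Z_q).

(** The Cayley tree T^d of order d: vertices are reduced words over the
    alphabet {0,..,d} (no two consecutive letters equal); the root is the
    empty word, and w is joined to each one-letter extension rcons w a.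
    The root has d+1 neighbours, every other vertex has its parent plus d
    children, so T^d is the (d+1)-regular tree. *)
Definition vert (d : nat) := {s : seq 'I_d.+1 | sorted (fun a b => a != b) s}.

Definition root (d : nat) : vert d := exist _ [::] isT.


Definition parent (d : nat) (v : vert d) : vert d :=
  insubd (root d) (take (size (val v)).-1 (val v)).

Definition children (d : nat) (v : vert d) : seq (vert d) :=
  pmap (fun a => insub (rcons (val v) a) : option (vert d)) (enum 'I_d.+1).

Definition nbrs (d : nat) (v : vert d) : seq (vert d) :=
  (if val v == [::] then [::] else [:: parent d v]) ++ children d v.

Definition config (d q : nat) := vert d -> spin q.

Definition cylinders (d q : nat) : set (set (config d q)) :=
  [set A | exists (v : vert d) (k : spin q), A = [set w | w v = k]].

Definition Omega (d q : nat) := g_sigma_algebraType (@cylinders d q).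

Section Model.
Context {R : realType} {d q : nat}.

(** Edges of T^d are indexed by non-root vertices w: w <-> {parent w, w}.
    [or w] gives the fixed orientation of that edge (true: parent -> w). *)
Definition edge_energy (u : spin q -> spin q -> R) (or : vert d -> bool)
  (xi : config d q) (w : vert d) : R :=
  if or w then u (xi (parent d w)) (xi w) else u (xi w) (xi (parent d w)).

Definition edges_meeting (L : seq (vert d)) : seq (vert d) :=
  undup [seq w <- L ++ flatten (map (children d) L) | val w != [::]].

Definition hamiltonian (u : spin q -> spin q -> R) (or : vert d -> bool)
  (L : seq (vert d)) (xi : config d q) : R :=
  \sum_(w <- edges_meeting L) edge_energy u or xi w.

Definition glue (L : seq (vert d)) (eta : {ffun 'I_(size L) -> spin q})
  (tau : config d q) : config d q :=
  fun v => match (insub (index v L) : option 'I_(size L)) with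
           | Some i => eta i
           | None => tau v
           end.

Definition boltz (beta : R) (u : spin q -> spin q -> R) (or : vert d -> bool)
  (L : seq (vert d)) (tau : config d q) (eta : {ffun 'I_(size L) -> spin q}) : R :=
  expR (- (beta * hamiltonian u or L (glue L eta tau))).

Definition gamma (beta : R) (u : spin q -> spin q -> R) (or : vert d -> bool)
  (L : seq (vert d)) (A : set (config d q)) (tau : config d q) : R :=
  (\sum_(eta : {ffun 'I_(size L) -> spin q})
      \1_A (glue L eta tau) * boltz beta u or L tau eta)
  / (\sum_(eta : {ffun 'I_(size L) -> spin q}) boltz beta u or L tau eta).

Definition is_gibbs (beta : R) (u : spin q -> spin q -> R) (or : vert d -> bool)
  (mu : probability (Omega d q) R) : Prop :=
  forall L : seq (vert d), uniq L ->
  forall A : set (Omega d q), measurable A ->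
    mu A = (\int[mu]_tau (gamma beta u or L A tau)%:E)%E.

Definition is_extremal_gibbs (beta : R) (u : spin q -> spin q -> R)
  (or : vert d -> bool) (mu : probability (Omega d q) R) : Prop :=
  forall (t : R) (mu1 mu2 : probability (Omega d q) R),
    0 < t < 1 -> is_gibbs beta u or mu1 -> is_gibbs beta u or mu2 ->
    (forall A : set (Omega d q), measurable A ->
        mu A = (t%:E * mu1 A + (1 - t)%:E * mu2 A)%E) ->
    forall A : set (Omega d q), measurable A -> mu1 A = mu2 A.

Definition is_offdiag_min (u : spin q -> spin q -> R) (m : R) : Prop :=
  (forall k l, k != l -> m <= u k l) /\ (exists k l, k != l /\ u k l = m).

Definition is_max_entry (u : spin q -> spin q -> R) (M : R) : Prop :=
  (forall k l, u k l <= M) /\ (exists k l, u k l = M).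

End Model.

Definition broken_deg (d q : nat) (w0 : config d q) (v : vert d) : nat :=
  count (fun w => w0 v != w0 w) (nbrs d v).

Definition ground_state (d q dmax : nat) (w0 : config d q) : Prop :=
  forall v : vert d, (broken_deg d q w0 v <= dmax)%N.

(* Main.v *)
(* Relative to a ground state [w0], let the message of a vertex be the vector of
   partition functions of the subtree below it, as a function of its spin and
   normalized at [w0]. The hypothesis makes a box of small deviations stable
   under the tree recursion: a deviation may have weight [x = e^(-beta umin)]
   across an unbroken edge and [y x^2], with [y = e^(-beta Umax)], across a broken
   one, and every step of the recursion gains a factor
   [z = e^(-beta ((d-1) umin - dmax (Umax + umin)))] up to constants.
   Running the recursion from all sides bounds the probability of a deviation at
   any vertex by a constant times [z]. Linearizing it shows that the influence of a spin on
   the spins [n] generations further decays like [(C z)^n] in total variation,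
   for the boundary condition sampled from the measure itself. A limit [mu] of the finite-volume
   measures thus asymptotically decorrelates local events from distant ones, which
   forces every Gibbs measure dominated by a multiple of [mu] to be [mu]; hence [mu]
   is extremal. The limit is realized as a measure by coding configurations
   by nested subintervals of [0, 1[ under Lebesgue measure. *)

Require Import Defs.
From HB Require Import structures.
From mathcomp Require Import all_boot all_order all_algebra.
From mathcomp Require Import all_classical all_reals all_analysis.
From mathcomp Require Import measurable_realfun.
From mathcomp Require Import ring lra.

Import Order.TTheory GRing.Theory Num.Theory numFieldNormedType.Exports.
Local Open Scope classical_set_scope.
Local Open Scope ring_scope.

(** The two sizes of the box are forced. Over all [d + 1] edges at a vertex, an unbroken edge
    contributes [x] and a broken one [1 / y], up to constants; with at most [dmax] broken edges the
    product is at most [z x^2]. A message leaves out the edge along which it travels, and dividing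
    by [x] or by [1 / y] leaves [z x] or [z y x^2]: [z] times the allowed deviations. The argument
    does not distinguish parent from child, so one box serves the messages in both directions.

    No monotonicity in the spins is available, and an influence bound uniform in the boundary
    condition must fail at low temperature, where distinct ground states give distinct measures.
    Hence influence is never a supremum over boundary conditions: the spins are summed out by
    positive operators acting on arbitrary bounded functions of the far spins, and the results are
    compared after weighting by the masses.

    The spins near the root are treated crudely, at a cost depending only on the radius of the local
    event; the contraction over the generations beyond that radius absorbs it. *)

Section Tree.
Context {d : nat}.
Implicit Types v w c : vert d.

Lemma insub_vert (s : seq 'I_d.+1) w :
  (insub s : option (vert d)) = Some w <-> val w = s.
Proof.
split=> [|<-]; last by rewrite valK.
by case: (insubP (vert d) s) => // w' _ <- [<-].
Qed.

Lemma mem_childrenP w c :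
  reflect (exists a : 'I_d.+1, val c = rcons (val w) a) (c \in children d w).
Proof.
rewrite /children mem_pmap; apply: (iffP mapP) => [[a _ /esym/insub_vert ca]|[a ca]].
  by exists a.
by exists a; rewrite ?mem_enum//; apply/esym/insub_vert.
Qed.

Lemma size_child w c : c \in children d w -> size (val c) = (size (val w)).+1.
Proof. by case/mem_childrenP => a ->; rewrite size_rcons. Qed.

Lemma child_neq_root w c : c \in children d w -> val c != [::].
Proof. by move/size_child; case: (val c). Qed.

Lemma parent_child w c : c \in children d w -> parent d c = w.
Proof.
case/mem_childrenP => a ca; rewrite /parent ca size_rcons/= -cats1.
rewrite take_cat ltnn subnn take0 cats0.
by apply: val_inj; rewrite val_insubd; case: (w) => s /= ->.
Qed.

Lemma val_parent w : val (parent d w) = take (size (val w)).-1 (val w).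
Proof.
by rewrite /parent val_insubd; case: w => s /= ss; rewrite take_sorted.
Qed.

Lemma parent_root : parent d (Defs.root d) = Defs.root d.
Proof. by apply: val_inj; rewrite val_parent. Qed.

Lemma mem_children w c : (c \in children d w) = (val c != [::]) && (parent d c == w).
Proof.
apply/idP/andP => [cw|[c0 /eqP<-]].
  by rewrite (child_neq_root w)// (parent_child w).
apply/mem_childrenP; rewrite val_parent.
move: c0; elim/last_ind: (val c) => // s a _ _; exists a.
by rewrite size_rcons/= -cats1 take_cat ltnn subnn take0 cats0 cats1.
Qed.

Lemma uniq_children w : uniq (children d w).
Proof.
rewrite /children.
pose f (a : 'I_d.+1) := insub (rcons (val w) a) : option (vert d).
pose g (c : vert d) : option 'I_d.+1 := Some (last ord0 (val c)).
have fg : ocancel f (fun c => last ord0 (val c)).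
  by move=> a; rewrite /f; case: (insubP (vert d)) => //= c _ ->; rewrite last_rcons.
exact: (pmap_uniq fg (enum_uniq _)).
Qed.

Lemma size_children_le w : (size (children d w) <= d.+1)%N.
Proof.
by rewrite /children size_pmap (leq_trans (count_size _ _))// size_enum_ord.
Qed.

(** A nonempty reduced word extends by every letter but its last one, the empty word by all
    letters. *)
Lemma size_children w : (size (children d w) + (val w != [::]))%N = d.+1.
Proof.
rewrite /children size_pmap.
have sorted_rcons (a : 'I_d.+1) : isSome (insub (rcons (val w) a) : option (vert d))
    = sorted (fun a b => a != b) (rcons (val w) a).
  by case: (insubP (vert d)) => [? ->//|/negbTE ->].
rewrite (eq_count (a2 := fun a => sorted (fun a b => a != b) (rcons (val w) a))) //.
case: w {sorted_rcons} => -[|x s] /= xs.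
  by rewrite count_predT size_enum_ord addn0.
rewrite (eq_count (a2 := predC (pred1 (last x s)))); last first.
  by move=> a; rewrite rcons_path xs/= eq_sym.
have := count_predC (pred1 (last x s)) (enum 'I_d.+1).
by rewrite size_enum_ord count_uniq_mem ?enum_uniq// mem_enum addnC.
Qed.

End Tree.

Lemma broken_deg_nbrs d q (w0 : config d q) (v : vert d) :
  broken_deg d q w0 v =
  ((val v != [::]) && (w0 v != w0 (parent d v))
   + count (fun c => w0 v != w0 c) (children d v))%N.
Proof.
rewrite /broken_deg /nbrs count_cat; congr addn.
by case: eqP => //= _; rewrite addn0.
Qed.

(** * Single-spin updates and subtrees *)

Section Update.
Context {d q : nat}.
Implicit Types (s : config d q) (v w : vert d) (k : spin q).

Definition upd s v k : config d q := fun v' => if v' == v then k else s v'.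

Lemma upd_same s v k : upd s v k v = k.
Proof. by rewrite /upd eqxx. Qed.

Lemma upd_neq s v k w : w != v -> upd s v k w = s w.
Proof. by rewrite /upd => /negbTE ->. Qed.

Lemma upd_upd s v k k' : upd (upd s v k) v k' = upd s v k'.
Proof. by apply: funext => w; rewrite /upd; case: eqP. Qed.

Lemma upd_id s v : upd s v (s v) = s.
Proof. by apply: funext => w; rewrite /upd; case: eqP => [->|]. Qed.

Lemma updC s v k w k' : v != w -> upd (upd s v k) w k' = upd (upd s w k') v k.
Proof.
move=> vw; apply: funext => x; rewrite /upd.
by case: (eqVneq x w) => // ->; rewrite eq_sym (negbTE vw).
Qed.

Definition indep {R : Type} v (f : config d q -> R) :=
  forall s k, f (upd s v k) = f s.

Definition below v w := prefix (val v) (val w).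

Lemma below_refl v : below v v.
Proof. exact: prefix_refl. Qed.

Lemma below_size v w : below v w -> (size (val v) <= size (val w))%N.
Proof. exact: size_prefix. Qed.

Lemma below_child v w c : c \in children d v -> below c w ->
  below v w /\ (size (val v) < size (val w))%N.
Proof.
move=> cv cw; split; last by rewrite -(size_child _ _ cv) below_size.
apply: prefix_trans cw; case/mem_childrenP: cv => a ->.
exact: prefix_rcons.
Qed.

Lemma below_children_disjoint v c c' w : c \in children d v ->
  c' \in children d v -> c != c' -> below c w -> ~~ below c' w.
Proof.
move=> cv c'v cc'; rewrite /below !prefixE (size_child _ _ cv) (size_child _ _ c'v).
by move=> /eqP ->; rewrite val_eqE.
Qed.

End Update.

(** * Positive linear operators of constant mass *)

Section PositiveOperators.
Context {R : realType} {T : Type}.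
Implicit Types (O P : (T -> R) -> T -> R) (f g : T -> R) (z : R).

(** In algebraic terms, [O] is [z] times a Markov operator. Since the image of 1 is a constant and
    not a function of the configuration, masses multiply under composition. *)
Definition pos_op O z :=
  [/\ forall x f g s, O (fun s => x * f s + g s) s = x * O f s + O g s,
      forall f, (forall s, 0 <= f s) -> forall s, 0 <= O f s &
      forall s, O (fun=> 1) s = z].

Lemma pos_op_id : pos_op (fun f => f) 1.
Proof. by split. Qed.

Lemma pos_op0 O z : pos_op O z -> O (fun=> 0) = fun=> 0.
Proof.
case=> lin _ _; apply: funext => s.
have /= := lin 1 (fun=> 0) (fun=> 0) s.
have -> : (fun s : T => 1 * 0 + 0) = (fun=> 0 :> R) by apply: funext => t; rewrite mulr0 addr0.
rewrite mul1r => OO; apply: (addrI (O (fun=> 0) s)); rewrite addr0.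
exact: esym.
Qed.

Lemma pos_opZ O z : pos_op O z -> forall x f, O (fun s => x * f s) = fun s => x * O f s.
Proof.
move=> O_; have O0 := pos_op0 _ _ O_; case: O_ => lin _ _ x f; apply: funext => s.
have := lin x f (fun=> 0) s; rewrite O0 addr0 => <-; congr (O _ s).
by apply: funext => t; rewrite addr0.
Qed.

Lemma pos_opD O z : pos_op O z -> forall f g, O (fun s => f s + g s) = fun s => O f s + O g s.
Proof.
case=> lin _ _ f g; apply: funext => s.
have := lin 1 f g s; rewrite mul1r => <-; congr (O _ s).
by apply: funext => t; rewrite mul1r.
Qed.

Lemma pos_opB O z : pos_op O z -> forall f g, O (fun s => f s - g s) = fun s => O f s - O g s.
Proof.
move=> O_ f g; rewrite (pos_opD _ _ O_); apply: funext => s; congr (_ + _).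
have -> : (fun s => - g s) = (fun s => -1 * g s) by apply: funext => t; rewrite mulN1r.
by rewrite (pos_opZ _ _ O_) mulN1r.
Qed.

Lemma pos_op_cst O z : pos_op O z -> forall x, O (fun=> x) = fun=> x * z.
Proof.
move=> O_ x; have := pos_opZ _ _ O_ x (fun=> 1); case: (O_) => _ _ O1.
move=> E; apply: funext => s; rewrite -(O1 s) -[RHS](congr1 (@^~ s) E).
by congr (O _ s); apply: funext => t; rewrite mulr1.
Qed.

Lemma pos_op_le O z : pos_op O z -> forall f g, (forall s, f s <= g s) ->
  forall s, O f s <= O g s.
Proof.
move=> O_ f g fg s; rewrite -subr_ge0 -[leRHS](congr1 (@^~ s) (pos_opB _ _ O_ g f)).
by case: O_ => _ pos _; apply: pos => t; rewrite subr_ge0.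
Qed.

Lemma pos_op_norm O z : pos_op O z -> forall f F, (forall s, `|f s| <= F) ->
  forall s, `|O f s| <= F * z.
Proof.
move=> O_ f F fF s; have fF' t := ler_normlP _ _ (fF t).
rewrite ler_norml -mulNr -[F * z](congr1 (@^~ s) (pos_op_cst _ _ O_ F)).
rewrite -[_ * z](congr1 (@^~ s) (pos_op_cst _ _ O_ (- F))).
by apply/andP; split; apply: (pos_op_le _ _ O_) => t; have := fF t;
  rewrite ler_norml => /andP[].
Qed.

Lemma pos_op_mass_ge0 O z (s : T) : pos_op O z -> 0 <= z.
Proof. by case=> _ pos O1; rewrite -(O1 s); apply: pos => t; exact: ler01. Qed.

Lemma pos_op_comp O P z z' : pos_op O z -> pos_op P z' ->
  pos_op (fun f => O (P f)) (z * z').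
Proof.
move=> O_ P_; split.
- move=> x f g s; case: O_ => linO _ _; case: P_ => linP _ _; rewrite -linO.
  by congr (O _ s); apply: funext => t; rewrite linP.
- by move=> f f0; case: O_ => _ pO _; case: P_ => _ pP _; apply: pO; apply: pP.
- move=> s; have -> : P (fun=> 1) = fun=> z' by apply: funext => t; case: P_ => _ _ ->.
  by rewrite (pos_op_cst _ _ O_) mulrC.
Qed.

Lemma pos_op_foldr {I : eqType} (r : seq I) (Os : I -> (T -> R) -> T -> R) (z : I -> R) :
  (forall i, i \in r -> pos_op (Os i) (z i)) ->
  pos_op (fun f => foldr Os f r) (\prod_(i <- r) z i).
Proof.
elim: r => [|i r IHr] Or; first by rewrite big_nil; exact: pos_op_id.
rewrite big_cons; apply: (pos_op_comp _ (fun f => foldr Os f r)).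
  by apply: Or; rewrite mem_head.
by apply: IHr => j jr; apply: Or; rewrite inE jr orbT.
Qed.

End PositiveOperators.

(** * The recursion for partition functions on subtrees *)

Section TreeOperators.
Context {R : realType} {d q : nat}.
Variables (a : vert d -> spin q -> spin q -> R) (w0 : config d q).
Hypothesis a_ge0 : forall w k l, 0 <= a w k l.
Implicit Types (s : config d q) (f g : config d q -> R) (v w c : vert d)
  (j k : spin q) (n : nat).

(* [node n w j f] sums [f] over the spins strictly below [w], down to [n - 1]
   generations, against the edge weights, when [w] carries [j]; the [n]-th
   generation is frozen to [w0]. *)
Fixpoint node n w j f : config d q -> R :=
  match n with
  | 0 => fun s => (j == w0 w)%:R * f s
  | n'.+1 => foldr (fun c g s => \sum_i a c j i * node n' c i g (upd s c i)) f
               (children d w)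
  end.

Definition branch n c j f s := \sum_i a c j i * node n c i f (upd s c i).

Fixpoint mass n w j : R :=
  match n with
  | 0 => (j == w0 w)%:R
  | n'.+1 => \prod_(c <- children d w) \sum_i a c j i * mass n' c i
  end.

Definition bmass n c j := \sum_i a c j i * mass n c i.

Lemma nodeS n w j f :
  node n.+1 w j f = foldr (fun c => branch n c j) f (children d w).
Proof. by []. Qed.

Lemma massS n w j : mass n.+1 w j = \prod_(c <- children d w) bmass n c j.
Proof. by []. Qed.

(** Conditional on [node], so that it can be used inside the induction of [node_pos_op]. *)
Lemma branch_pos_op_of_node n c k : (forall j, pos_op (node n c j) (mass n c j)) ->
  pos_op (branch n c k) (bmass n c k).
Proof.
move=> node_; split.
- move=> x f g s; rewrite /branch mulr_sumr -big_split; apply: eq_bigr => i _ /=.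
  by case: (node_ i) => lin _ _; rewrite lin; ring.
- move=> f f0 s; apply: sumr_ge0 => i _; rewrite mulr_ge0//.
  by case: (node_ i) => _ pos _; exact: pos.
- by move=> s; apply: eq_bigr => i _; case: (node_ i) => _ _ ->.
Qed.

Lemma node_pos_op n w j : pos_op (node n w j) (mass n w j).
Proof.
elim: n w j => [|n IHn] w j.
  split=> [x f g s|f f0 s|s] /=; first by ring.
    by rewrite mulr_ge0.
  by rewrite mulr1.
by apply: pos_op_foldr => c _; apply: branch_pos_op_of_node => i; exact: IHn.
Qed.

Lemma branch_pos_op n c k : pos_op (branch n c k) (bmass n c k).
Proof. by apply: branch_pos_op_of_node => j; exact: node_pos_op. Qed.

Lemma mass_ge0 n w j : 0 <= mass n w j.
Proof. exact: (pos_op_mass_ge0 _ _ w0 (node_pos_op n w j)). Qed.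

Lemma bmass_ge0 n w j : 0 <= bmass n w j.
Proof. exact: (pos_op_mass_ge0 _ _ w0 (branch_pos_op n w j)). Qed.

Lemma foldr_indep {I : Type} (r : seq I) (Os : I -> (config d q -> R) -> config d q -> R) v f :
  (forall i g, indep v g -> indep v (Os i g)) -> indep v f -> indep v (foldr Os f r).
Proof. by move=> Ov fv; elim: r => //= i r; exact: Ov. Qed.

Lemma branch_indep_of_node n c k v f :
  (forall j, indep v (node n c j f)) -> indep v (branch n c k f).
Proof.
move=> node_ s l; apply: eq_bigr => i _; congr (_ * _).
have [->|vc] := eqVneq v c; first by rewrite upd_upd.
by rewrite updC// node_.
Qed.

Lemma node_indep n w j v f : indep v f -> indep v (node n w j f).
Proof.
elim: n w j f => [|n IHn] w j f fv /=; first by move=> s k; rewrite fv.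
apply: foldr_indep => // c g gv; apply: branch_indep_of_node => i; exact: IHn.
Qed.

Lemma branch_indep n c k v f : indep v f -> indep v (branch n c k f).
Proof. by move=> fv; apply: branch_indep_of_node => j; exact: node_indep. Qed.

(** All spins summed by [node n w j] lie strictly below [w], so [f] is constant for every sum. *)
Lemma node_pull n w j f g :
  (forall v, below w v -> (size (val w) < size (val v))%N -> indep v f) ->
  node n w j (fun s => f s * g s) = fun s => f s * node n w j g s.
Proof.
elim: n w j f g => [|n IHn] w j f g fw; first by apply: funext => s /=; ring.
rewrite !nodeS.
have fc c : c \in children d w -> forall v, below c v -> indep v f.
  by move=> cw v /(below_child _ _ _ cw)[? ?]; exact: fw.
elim: (children d w) fc => //= c r IHr fc; rewrite IHr; last first.
  by move=> c' c'r; apply: fc; rewrite inE c'r orbT.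
have {}fc := fc c (mem_head _ _).
apply: funext => s; rewrite mulr_sumr; apply: eq_bigr => i _.
rewrite IHn; last by move=> v cv _; exact: fc.
by rewrite (fc c (below_refl c)) mulrCA.
Qed.

Lemma branch_pull n c k f g : (forall v, below c v -> indep v f) ->
  branch n c k (fun s => f s * g s) = fun s => f s * branch n c k g s.
Proof.
move=> fc; apply: funext => s; rewrite /branch mulr_sumr; apply: eq_bigr => i _.
rewrite node_pull; last by move=> v cv _; exact: fc.
by rewrite (fc c (below_refl c)) mulrCA.
Qed.

Lemma node_mass n w j f :
  (forall v, below w v -> (size (val w) < size (val v))%N -> indep v f) ->
  node n w j f = fun s => f s * mass n w j.
Proof.
move=> fw; have := node_pull n w j f (fun=> 1) fw.
have -> : (fun s => f s * 1) = f by apply: funext => s; rewrite mulr1.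
by move=> ->; apply: funext => s; case: (node_pos_op n w j) => _ _ ->.
Qed.

Lemma branch_mass n c k f : (forall v, below c v -> indep v f) ->
  branch n c k f = fun s => f s * bmass n c k.
Proof.
move=> fc; have := branch_pull n c k f (fun=> 1) fc.
have -> : (fun s => f s * 1) = f by apply: funext => s; rewrite mulr1.
by move=> ->; apply: funext => s; case: (branch_pos_op n c k) => _ _ ->.
Qed.

End TreeOperators.

(** * Passing a message across one edge *)

Section EdgeEstimates.
Context {R : realType} {I : finType}.
Variables (A : I -> I -> R) (x y : R) (kv kc : I).
Hypotheses (A_le1 : forall k j, A k j <= 1) (A_diag : forall k, A k k = 1)
  (A_off : forall k j, k != j -> A k j <= x) (A_ge : forall k j, y <= A k j)
  (y_gt0 : 0 < y) (x_ge0 : 0 <= x) (x_le1 : x <= 1).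

Let Q : R := #|I|%:R.

Let y_le1 : y <= 1. Proof. by rewrite -(A_diag kv). Qed.

Let A_ge0 k j : 0 <= A k j. Proof. exact: le_trans (ltW y_gt0) (A_ge k j). Qed.

(* The weight allowed for a deviation at [kc], and the resulting factor felt
   across the edge; their product is [Q * x ^+ 2] in both cases. *)
Definition edge_eps := if kc == kv then x else y * x ^+ 2.
Definition edge_factor := if kc == kv then Q * x else Q / y.

Lemma edge_eps_factor : edge_eps * edge_factor = Q * x ^+ 2.
Proof.
rewrite /edge_eps /edge_factor; case: eqP => _; first by ring.
by field; rewrite gt_eqF.
Qed.

Lemma edge_eps_ge0 : 0 <= edge_eps.
Proof. by rewrite /edge_eps; case: eqP => _ //; rewrite mulr_ge0 ?exprn_ge0 ?(ltW y_gt0). Qed.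

Lemma edge_eps_le1 : edge_eps <= 1.
Proof.
rewrite /edge_eps; case: eqP => _ //.
by rewrite mulr_ile1 ?exprn_ge0 ?exprn_ile1 ?(ltW y_gt0).
Qed.

Lemma edge_factor_ge0 : 0 <= edge_factor.
Proof.
by rewrite /edge_factor; case: eqP => _; rewrite mulr_ge0 ?invr_ge0 ?ler0n ?(ltW y_gt0).
Qed.

Lemma edge_factor_le : edge_factor <= Q / y.
Proof.
rewrite /edge_factor; case: eqP => _ //; rewrite ler_wpM2l ?ler0n//.
by rewrite (le_trans x_le1)// invf_ge1.
Qed.

Variable m : I -> R.
Hypotheses (m_ge0 : forall j, 0 <= m j).

Lemma edge_sum_ge : y * m kc <= \sum_j A kv j * m j.
Proof.
rewrite (bigD1 kc)//= -[leLHS]addr0 lerD ?ler_wpM2r//.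
by apply: sumr_ge0 => j _; rewrite mulr_ge0.
Qed.

Lemma edge_sum_ge_unbroken : kc = kv -> m kc <= \sum_j A kv j * m j.
Proof.
move=> kcv; rewrite (bigD1 kc)//= -[leLHS]addr0 lerD ?kcv ?A_diag ?mul1r//.
by apply: sumr_ge0 => j _; rewrite mulr_ge0.
Qed.

Hypothesis m_box : forall j, j != kc -> m j <= edge_eps * m kc.

(** If [kc = kv], each of the [Q] terms on the left is at most [x * m kc], the term [kc] by its edge
    weight and the others by the box, while the sum on the right is at least [m kc]. If [kc != kv],
    the two bounds are [m kc] and [y * m kc]. *)
Lemma edge_ratio k : k != kv ->
  \sum_j A k j * m j <= edge_factor * \sum_j A kv j * m j.
Proof.
move=> kkv; rewrite /edge_factor.
have [kcv|kcv] := eqVneq kc kv.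
  rewrite (@le_trans _ _ (Q * x * m kc))//; last first.
    by rewrite ler_wpM2l ?edge_sum_ge_unbroken// mulr_ge0 ?ler0n.
  rewrite (@le_trans _ _ (\sum_(j : I) x * m kc))//; last first.
    by rewrite sumr_const -mulr_natl mulrA.
  apply: ler_sum => j _; have [->|jkc] := eqVneq j kc.
    by rewrite ler_wpM2r// A_off// kcv.
  rewrite -[leRHS]mul1r ler_pM//.
  by have := m_box _ jkc; rewrite /edge_eps kcv eqxx.
rewrite (@le_trans _ _ (Q * m kc))//; last first.
  rewrite -mulrA ler_wpM2l ?ler0n// ler_pdivlMl//; exact: edge_sum_ge.
rewrite (@le_trans _ _ (\sum_(j : I) m kc))//; last first.
  by rewrite sumr_const -mulr_natl.
apply: ler_sum => j _; rewrite -[leRHS]mul1r ler_pM//.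
have [->//|jkc] := eqVneq j kc.
by rewrite (le_trans (m_box _ jkc))// ler_piMl// edge_eps_le1.
Qed.

(** Linearization of the message ratio: the left side vanishes when [G] is proportional to [m], so
    only the defect [dl] of proportionality enters. *)
Lemma edge_perturb (G : I -> R) (e : R) k : 0 <= e -> 0 < m kc -> k != kv ->
  (forall j, j != kc -> `|G j - m j / m kc * G kc| <= edge_eps * e * m kc) ->
  `|\sum_j A k j * G j
    - (\sum_j A k j * m j) / (\sum_j A kv j * m j) * \sum_j A kv j * G j|
  <= (1 + Q) * edge_factor * e * \sum_j A kv j * m j.
Proof.
move=> e0 m0 kkv GB.
pose dl j := G j - m j / m kc * G kc.
have GE l : \sum_j A l j * G j = G kc / m kc * (\sum_j A l j * m j) + \sum_j A l j * dl j.
  rewrite mulr_sumr -big_split; apply: eq_bigr => j _ /=; rewrite /dl.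
  by field; rewrite gt_eqF.
have S0 : 0 < \sum_j A kv j * m j by rewrite (lt_le_trans _ edge_sum_ge)// mulr_gt0.
set S := \sum_j A kv j * m j in S0 *; set rho := _ / S.
have rho_le : rho <= edge_factor by rewrite ler_pdivrMr//; exact: edge_ratio.
have rho_ge0 : 0 <= rho.
  by rewrite divr_ge0 ?(ltW S0)// sumr_ge0// => j _; rewrite mulr_ge0.
have -> : \sum_j A k j * G j - rho * \sum_j A kv j * G j =
    \sum_j A k j * dl j - rho * \sum_j A kv j * dl j.
  by rewrite !GE -/S /rho; field; rewrite !gt_eqF.
have dlB l : `|\sum_j A l j * dl j| <= Q * (edge_eps * e * m kc).
  rewrite (le_trans (ler_norm_sum _ _ _))//.
  rewrite (@le_trans _ _ (\sum_(j : I) edge_eps * e * m kc))//; last first.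
    by rewrite sumr_const -mulr_natl.
  have ? : 0 <= edge_eps * e * m kc by rewrite !mulr_ge0 ?edge_eps_ge0.
  apply: ler_sum => j _; rewrite normrM (ger0_norm (A_ge0 _ _)).
  rewrite -[leRHS]mul1r ler_pM//.
  have [->|jkc] := eqVneq j kc; last exact: GB.
  by rewrite /dl divff ?gt_eqF// mul1r subrr normr0.
have Q0 : 0 <= Q by exact: ler0n.
rewrite (le_trans (ler_normB _ _))// normrM (ger0_norm rho_ge0).
rewrite (@le_trans _ _ ((1 + rho) * (Q * (edge_eps * e * m kc))))//.
  by rewrite mulrDl mul1r lerD ?ler_wpM2l.
have rho1 : 0 <= 1 + rho by rewrite addr_ge0.
have mkc0 := ltW m0; have y0 := ltW y_gt0.
have := rho_le; rewrite /edge_eps /edge_factor.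
have [kcv|kcv] := eqVneq kc kv => rhoB.
  have -> : (1 + Q) * (Q * x) * e * S = (1 + Q) * (Q * (x * e * S)) by ring.
  apply: ler_pM => //; first by rewrite !mulr_ge0.
    by rewrite lerD2l (le_trans rhoB)// ler_piMr.
  rewrite ler_wpM2l// ler_wpM2l ?mulr_ge0//; exact: edge_sum_ge_unbroken.
(* Across a broken edge [1 + rho] can be of order [1 / y], which the target allows; the factor [y]
   of [edge_eps] is spent on [y * m kc <= S]. *)
have -> : (1 + rho) * (Q * (y * x ^+ 2 * e * m kc)) =
    (1 + rho) * (Q * (x ^+ 2 * e) * (y * m kc)) by ring.
have -> : (1 + Q) * (Q / y) * e * S = ((1 + Q) / y) * ((Q * (1 * e)) * S) by ring.
apply: ler_pM => //; first by rewrite !mulr_ge0 ?exprn_ge0.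
  by rewrite mulrDl lerD// mul1r invf_ge1.
apply: ler_pM; rewrite ?mulr_ge0 ?exprn_ge0//; last exact: edge_sum_ge.
by rewrite ler_wpM2l// ler_wpM2r// exprn_ile1.
Qed.

End EdgeEstimates.

Lemma edge_epsC (R : realType) (I : finType) (x y : R) (k l : I) :
  edge_eps x y k l = edge_eps x y l k.
Proof. by rewrite /edge_eps eq_sym. Qed.

Lemma edge_factorC (R : realType) (I : finType) (x y : R) (k l : I) :
  edge_factor x y k l = edge_factor x y l k.
Proof. by rewrite /edge_factor eq_sym. Qed.

(** * Comparison of products of operators *)

Section Telescope.
Context {R : realType} {T : Type} {I : eqType}.
Variables (P O : I -> (T -> R) -> T -> R) (p o b : I -> R) (K : (T -> R) -> Prop) (kap : R).

(* Swapping the factors of a product of positive operators one at a time. *)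
Lemma telescope (r : seq I) :
  0 <= kap ->
  (forall i, i \in r -> pos_op (P i) (p i)) ->
  (forall i, i \in r -> pos_op (O i) (o i)) ->
  (forall i, i \in r -> 0 < o i) ->
  (forall i, i \in r -> p i <= b i * o i) ->
  (forall i, i \in r -> 0 <= b i) ->
  (forall i h, i \in r -> K h -> K (O i h)) ->
  (forall i h H, i \in r -> K h -> (forall s, `|h s| <= H) ->
    forall s, `|P i h s - p i / o i * O i h s| <= kap * b i * o i * H) ->
  forall h H, K h -> (forall s, `|h s| <= H) -> forall s,
  `|foldr P h r s - (\prod_(i <- r) (p i / o i)) * foldr O h r s|
    <= (size r)%:R * kap * (\prod_(i <- r) b i) * (\prod_(i <- r) o i) * H.
Proof.
move=> kap0; elim: r => [|i r IHr] Pp Oo o0 pb b0 KO PO h H Kh hH s.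
  by rewrite !big_nil /= !mul1r subrr normr0 !mul0r.
have sub j : j \in r -> j \in i :: r by rewrite inE orbC => ->.
have {}IHr := IHr (fun j jr => Pp j (sub j jr)) (fun j jr => Oo j (sub j jr))
  (fun j jr => o0 j (sub j jr)) (fun j jr => pb j (sub j jr))
  (fun j jr => b0 j (sub j jr)) (fun j h jr => KO j h (sub j jr))
  (fun j h H jr => PO j h H (sub j jr)) h H Kh hH.
have ir := mem_head i r.
have Kr : K (foldr O h r).
  move: KO; clear -Kh; elim: r => //= j r IHr KO; apply: (KO j); first by rewrite !inE eqxx orbT.
  by apply: IHr => l g lr; apply: KO; move: lr; rewrite !inE => /orP[->|->]; rewrite ?orbT.
have Oh t : `|foldr O h r t| <= H * \prod_(j <- r) o j.
  by apply: (pos_op_norm (fun h => foldr O h r)) => //; apply: pos_op_foldr => j jr; exact/Oo/sub.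
have prodo0 : 0 < \prod_(j <- r) o j by rewrite big_seq prodr_gt0// => j jr; exact/o0/sub.
have H0 : 0 <= H by exact: le_trans (hH s).
have rho0 : 0 <= \prod_(j <- r) (p j / o j).
  rewrite big_seq prodr_ge0// => j jr; rewrite divr_ge0 ?(ltW (o0 _ (sub _ jr)))//.
  exact: pos_op_mass_ge0 s (Pp _ (sub _ jr)).
have rhoo : \prod_(j <- r) (p j / o j) * \prod_(j <- r) o j <= \prod_(j <- r) b j * \prod_(j <- r) o j.
  rewrite -!big_split big_seq [leRHS]big_seq; apply: ler_prod => j jr /=.
  have oj := o0 _ (sub _ jr); rewrite divfK ?gt_eqF//.
  by rewrite (pos_op_mass_ge0 _ _ s (Pp _ (sub _ jr))) pb// sub.
rewrite !big_cons /=; set rho := \prod_(j <- r) (p j / o j) in rho0 rhoo IHr *.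
set B := \prod_(j <- r) b j in rhoo IHr *; set o' := \prod_(j <- r) o j in prodo0 rhoo IHr Oh *.
(* The tail is exchanged first, under [P i]. The one-step bound is then applied only to
   [foldr O h r], which stays in the class [K]. *)
have -> : P i (foldr P h r) s - p i / o i * rho * O i (foldr O h r) s =
    P i (fun t => foldr P h r t - rho * foldr O h r t) s +
    rho * (P i (foldr O h r) s - p i / o i * O i (foldr O h r) s).
  rewrite (pos_opB _ _ (Pp _ ir)) (pos_opZ _ _ (Pp _ ir)); ring.
rewrite (le_trans (ler_normD _ _))// normrM (ger0_norm rho0).
have IHs := pos_op_norm _ _ (Pp _ ir) _ _ IHr s.
have POs := PO i _ _ ir Kr Oh s.
have B0 : 0 <= B by rewrite /B big_seq prodr_ge0// => j jr; exact/b0/sub.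
rewrite (le_trans (lerD IHs (ler_wpM2l rho0 POs)))//.
have -> : (size r).+1%:R * kap * (b i * B) * (o i * o') * H =
    (size r)%:R * kap * B * o' * H * (b i * o i) + kap * b i * o i * H * (B * o').
  by rewrite -natr1; ring.
have -> : rho * (kap * b i * o i * (H * o')) = kap * b i * o i * H * (rho * o') by ring.
have oi := ltW (o0 _ ir); have bi := b0 _ ir.
by rewrite lerD// ler_wpM2l ?pb ?mulr_ge0 ?ler0n// ltW.
Qed.

End Telescope.

(** * Stability of the box of messages around a ground state *)

Section GroundState.
Context {R : realType} {d q dmax : nat}.
Variables (a : vert d -> spin q -> spin q -> R) (w0 : config d q) (x y z : R).
Hypotheses (a_le1 : forall w k j, a w k j <= 1) (a_diag : forall w k, a w k k = 1)
  (a_off : forall w k j, k != j -> a w k j <= x) (a_ge : forall w k j, y <= a w k j)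
  (y_gt0 : 0 < y) (x_gt0 : 0 < x) (x_le1 : x <= 1) (z_ge0 : 0 <= z)
  (dmax_le : (dmax <= d)%N) (w0_ground : ground_state d q dmax w0).

Let Q : R := #|{: spin q}|%:R.
Let Z := Q ^+ d.+1 * z.

(* The Peierls condition: flipping a vertex with at most [dmax] broken bonds. *)
Hypotheses (peierls : forall b, (b <= dmax)%N -> x ^+ (d - b) / y ^+ b <= z * x)
  (Z_le1 : Z <= 1).

Let Q_ge1 : 1 <= Q.
Proof. by rewrite /Q ler1n; apply/card_gt0P; exists (w0 (Defs.root d)). Qed.

Let x_ge0 := ltW x_gt0.

Let Q_ge0 : 0 <= Q. Proof. exact: ler0n. Qed.

Let y_le1 : y <= 1.
Proof. by rewrite -(a_diag (Defs.root d) (w0 (Defs.root d))). Qed.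

Let a_ge0 w k j : 0 <= a w k j. Proof. exact: le_trans (ltW y_gt0) (a_ge w k j). Qed.

Let Z_ge0 : 0 <= Z. Proof. by rewrite mulr_ge0// exprn_ge0. Qed.

Let eps (c : vert d) := edge_eps x y (w0 (parent d c)) (w0 c).
Let bf (c : vert d) := edge_factor x y (w0 (parent d c)) (w0 c).

Let eps_ge0 c : 0 <= eps c.
Proof. by apply: edge_eps_ge0 => //; rewrite ltW. Qed.

Let bf_ge0 c : 0 <= bf c.
Proof. by apply: edge_factor_ge0 => //; rewrite ltW. Qed.

Let bf_gt0 c : 0 < bf c.
Proof.
have Q0 : 0 < Q by rewrite (lt_le_trans _ Q_ge1).
by rewrite /bf /edge_factor; case: eqP => _; rewrite ?mulr_gt0 ?invr_gt0.
Qed.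

Let eps_le1 c : eps c <= 1.
Proof. by apply: (edge_eps_le1 (a c)) => //; rewrite ltW. Qed.

Lemma bf_prod (r : seq (vert d)) v : (forall c, c \in r -> parent d c = v) ->
  \prod_(c <- r) bf c = Q ^+ size r * x ^+ (size r - count (fun c => w0 v != w0 c) r)
    / y ^+ count (fun c => w0 v != w0 c) r.
Proof.
elim: r => [|c r IHr] rv; first by rewrite big_nil /= subn0 !expr0 invr1 !mulr1.
rewrite big_cons IHr; last by move=> c' c'r; apply: rv; rewrite inE c'r orbT.
rewrite /bf /edge_factor (rv c (mem_head _ _)) /= eq_sym.
have le_count := count_size (fun c => w0 v != w0 c) r.
case: eqVneq => _ /=.
  by rewrite add0n subSn// !exprS; ring.
by rewrite add1n subSS !exprS invfM; ring.
Qed.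

Definition bf_up v := if val v == [::] then 1 else bf v.

(** Each of the [d.+1] edges at [v] contributes [Q * x] or [Q / y]. The Peierls condition accounts
    for [d] of these powers, and the remaining edge supplies a second factor [x]. *)
Lemma bf_full v : bf_up v * \prod_(c <- children d v) bf c <= Z * x ^+ 2.
Proof.
rewrite (bf_prod _ v); last by move=> c /parent_child.
have := w0_ground v; rewrite broken_deg_nbrs; have := size_children v.
set nc := size _; set b := count _ _ => ncE bE.
have bnc : (b <= nc)%N by exact: count_size.
have yi m : 0 <= y^-1 ^+ m by rewrite exprn_ge0// invr_ge0 ltW.
rewrite /bf_up; case: eqP ncE bE => /= [_|v0].
  rewrite addn0 add0n mul1r => -> bd; rewrite /Z -!mulrA ler_wpM2l ?exprn_ge0//.
  have -> : x ^+ (d.+1 - b) / y ^+ b = x ^+ (d - b) / y ^+ b * x.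
    by rewrite subSn 1?(leq_trans bd)// exprSr; ring.
  by rewrite expr2 mulrA ler_wpM2r ?(ltW x_gt0)// peierls.
rewrite addn1 => -[->]; rewrite /bf /edge_factor eq_sym.
case: eqVneq => /= _ bd.
  have -> : Q * x * (Q ^+ d * x ^+ (d - b) / y ^+ b) = Q ^+ d.+1 * (x * (x ^+ (d - b) / y ^+ b)).
    by rewrite exprS; ring.
  have -> : Z * x ^+ 2 = Q ^+ d.+1 * (x * (z * x)) by rewrite /Z; ring.
  by rewrite ler_wpM2l ?exprn_ge0// ler_wpM2l ?(ltW x_gt0)// peierls.
have -> : Q / y * (Q ^+ d * x ^+ (d - b) / y ^+ b) =
    Q ^+ d.+1 * (x ^+ (d - b.+1) / y ^+ b.+1 * x).
  rewrite -subnSK 1?(leq_trans bd)// !exprS invfM; ring.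
have -> : Z * x ^+ 2 = Q ^+ d.+1 * (z * x * x) by rewrite /Z; ring.
by rewrite ler_wpM2l ?exprn_ge0// ler_wpM2r ?(ltW x_gt0)// peierls.
Qed.

Let eps_bf c : eps c * bf c = Q * x ^+ 2.
Proof. exact: edge_eps_factor. Qed.

Lemma bf_full_le c : Z * x ^+ 2 <= Z * eps c * bf c.
Proof.
rewrite -mulrA eps_bf ler_wpM2l// -[leLHS]mul1r ler_wpM2r// exprn_ge0// ltW//.
Qed.

(** This is [bf_full] divided by the factor of the edge to the parent: by [eps_bf] and [1 <= Q],
    [x ^+ 2 / bf v] is at most [eps v]. *)
Lemma bf_children v : \prod_(c <- children d v) bf c <= Z * eps v.
Proof.
have := bf_full v; rewrite /bf_up; case: eqP => [v0|_].
  have -> : v = Defs.root d by apply: val_inj.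
  (* The root is its own parent, so [eps] takes its unbroken value [x] there. *)
  rewrite mul1r /eps /edge_eps parent_root eqxx => /le_trans; apply.
  by rewrite ler_wpM2l// expr2 ler_piMr// (ltW x_gt0).
move/le_trans/(_ (bf_full_le v)); rewrite mulrC.
by rewrite ler_pM2r.
Qed.

Lemma bmass_ge n w c : c \in children d w -> y * mass a w0 n c (w0 c) <= bmass a w0 n c (w0 w).
Proof. by move=> cw; apply: edge_sum_ge => // j; exact: mass_ge0. Qed.

Lemma mass_gt0 n w : 0 < mass a w0 n w (w0 w).
Proof.
elim: n w => [|n IHn] w; first by rewrite /= eqxx.
rewrite massS big_seq prodr_gt0// => c cw.
by rewrite (lt_le_trans _ (bmass_ge n _ _ cw))// mulr_gt0.
Qed.

Lemma bmass_gt0 n w c : c \in children d w -> 0 < bmass a w0 n c (w0 w).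
Proof. by move=> cw; rewrite (lt_le_trans _ (bmass_ge n _ _ cw))// mulr_gt0// mass_gt0. Qed.

Lemma bmass_ratio_of_box n w c k :
  (forall j, j != w0 c -> mass a w0 n c j <= eps c * mass a w0 n c (w0 c)) ->
  c \in children d w -> k != w0 w ->
  bmass a w0 n c k <= bf c * bmass a w0 n c (w0 w).
Proof.
move=> box cw kw; have pc := parent_child _ _ cw.
rewrite /bf pc; apply: edge_ratio => //; [exact: a_off| |].
  by move=> j; exact: mass_ge0.
by move=> j jc; rewrite -pc; exact: box.
Qed.

(** At depth 0 a deviation has weight 0. In the induction the children are in the box because
    [Z <= 1], their branches then have ratios at most [bf], and [bf_children] multiplies these
    ratios to [Z * eps w]. *)
Lemma mass_box n w k : k != w0 w ->
  mass a w0 n w k <= Z * eps w * mass a w0 n w (w0 w).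
Proof.
elim: n w k => [|n IHn] w k kw.
  by rewrite /= (negbTE kw) eqxx mulr1 mulr_ge0.
have box c j : j != w0 c -> mass a w0 n c j <= eps c * mass a w0 n c (w0 c).
  move=> jc; rewrite (le_trans (IHn _ _ jc))// ler_wpM2r ?mass_ge0//.
  by rewrite ler_piMl.
rewrite !massS (le_trans _ (ler_wpM2r _ (bf_children w)))//; last first.
  by rewrite prodr_ge0// => c _; exact: bmass_ge0.
rewrite -big_split big_seq [leRHS]big_seq; apply: ler_prod => c cw /=.
by rewrite bmass_ge0//=; apply: bmass_ratio_of_box => // j; exact: box.
Qed.

Lemma mass_box1 n w k : k != w0 w ->
  mass a w0 n w k <= eps w * mass a w0 n w (w0 w).
Proof.
move=> kw; rewrite (le_trans (mass_box _ _ _ kw))// ler_wpM2r ?mass_ge0//.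
by rewrite ler_piMl.
Qed.

Lemma bmass_ratio n w c k : c \in children d w -> k != w0 w ->
  bmass a w0 n c k <= bf c * bmass a w0 n c (w0 w).
Proof. by apply: bmass_ratio_of_box => j; exact: mass_box1. Qed.

Lemma bmass_ratio_crude n w c k : c \in children d w ->
  bmass a w0 n c k <= Q / y * bmass a w0 n c (w0 w).
Proof.
move=> cw; have [->|kw] := eqVneq k (w0 w).
  by rewrite ler_peMl ?bmass_ge0// ler_pdivlMr// mul1r (le_trans y_le1).
rewrite (le_trans (bmass_ratio n _ _ _ cw kw))// ler_wpM2r ?bmass_ge0//.
by apply: (edge_factor_le (a c)).
Qed.

Definition root_sum M f := \sum_k node a w0 M.+1 (Defs.root d) k f (upd w0 (Defs.root d) k).

(** The far observables of the decorrelation argument; [sum_le] gives the near ones. *)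
Definition sum_lt N (h : config d q -> R) :=
  forall v, (size (val v) < N)%N -> indep v h.

(** * Messages from the parent, and deviations at a single vertex *)

Lemma branches_single n k w c (r : seq (vert d)) f : uniq r -> c \in r ->
  {subset r <= children d w} -> (forall v, ~~ below c v -> indep v f) ->
  foldr (fun c => branch a w0 n c k) f r =
  fun s => (\prod_(c' <- r | c' != c) bmass a w0 n c' k) * branch a w0 n c k f s.
Proof.
move=> ur cr rw fc.
have indep_f c' g : c' \in r -> c' != c -> (forall v, ~~ below c v -> indep v g) ->
    branch a w0 n c' k g = fun s => g s * bmass a w0 n c' k.
  move=> c'r c'c gc; apply: branch_mass => // v c'v; apply: gc.
  by apply: below_children_disjoint c'v => //; exact: rw.
have branch_f v : ~~ below c v -> indep v (branch a w0 n c k f).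
  by move=> cv; apply: branch_indep; exact: fc.
elim: r ur cr rw indep_f => //= c' r IHr /andP[c'r ur] cr rw indep_f.
have {}IHr := IHr ur _ (fun v vr => rw v (mem_behead (vr : v \in behead (c' :: r))))
  (fun v g vr => indep_f v g (mem_behead (vr : v \in behead (c' :: r)))).
rewrite big_cons; have [E|c'c] := eqVneq c' c; last first.
  rewrite IHr; last by move: cr; rewrite inE eq_sym (negbTE c'c).
  have := indep_f c' (fun s => (\prod_(c' <- r | c' != c) bmass a w0 n c' k) * branch a w0 n c k f s).
  move=> ->//; first by apply: funext => s /=; ring.
    exact: mem_head.
  by move=> v cv s l; rewrite branch_f.
subst c'; have -> : foldr (fun c => branch a w0 n c k) f r =
    fun s => (\prod_(c' <- r | c' != c) bmass a w0 n c' k) * f s.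
  have : forall c', c' \in r -> branch a w0 n c' k f = fun s => f s * bmass a w0 n c' k.
    move=> c' c'r'; apply: indep_f => //; first by rewrite inE c'r' orbT.
    by apply: contraNneq c'r => <-.
  elim: r c'r {ur cr rw indep_f IHr} => [|c' r IHr] c'r H /=.
    by apply: funext => s; rewrite big_nil mul1r.
  move: c'r; rewrite inE negb_or => /andP[cc' cr].
  rewrite IHr//; last by move=> v vr; apply: H; rewrite inE vr orbT.
  rewrite (pos_opZ _ _ (branch_pos_op a w0 a_ge0 n c' k)) H ?mem_head// big_cons eq_sym cc'.
  by apply: funext => s; rewrite /=; ring.
by rewrite (pos_opZ _ _ (branch_pos_op a w0 a_ge0 n c k)).
Qed.

(* [U] is the message reaching [v] from its parent: the weight of everything
   outside the subtree below [v] as a function of the spin at [v]. *)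
Lemma up_message M v : (size (val v) <= M)%N ->
  exists U : spin q -> R, [/\ forall k, 0 <= U k, 0 < U (w0 v),
    forall k, k != w0 v -> U k <= bf_up v * U (w0 v) &
    forall f, (forall u, ~~ below v u -> indep u f) -> root_sum M f =
      \sum_k U k * node a w0 (M.+1 - size (val v)) v k f (upd w0 v k)].
Proof.
move Em : (size (val v)) => m; elim: m v Em => [|m IHm] v vm mM.
  have -> : v = Defs.root d by apply: val_inj => /=; exact: size0nil.
  exists (fun=> 1); split=> //; first by move=> k _; rewrite /bf_up eqxx mulr1.
  by move=> f _; rewrite subn0; apply: eq_bigr => k _; rewrite mul1r.
pose w := parent d v.
have vw : v \in children d w by rewrite mem_children eqxx andbT; case: (val v) vm.
have wm : size (val w) = m by have := size_child _ _ vw; rewrite vm => -[->].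
have [U [U0 U1 Uw UE]] := IHm w wm (ltnW mM).
have Mm : (M.+1 - m = (M.+1 - m.+1).+1)%N by rewrite subnSK// ltnS ltnW.
set n := (M.+1 - m.+1)%N in Mm *.
pose S k := \prod_(c <- children d w | c != v) bmass a w0 n c k.
have S0 k : 0 <= S k by rewrite prodr_ge0// => c _; exact: bmass_ge0.
have Sw : 0 < S (w0 w).
  by rewrite /S big_seq_cond prodr_gt0// => c /andP[cw _]; exact: bmass_gt0.
(* Here [bf_full] at [w] is divided by the factor of the edge to the child [v] instead of the one to
   the parent. As [edge_eps] and [edge_factor] are symmetric, the message that [w] sends down to [v]
   lies in the same box as those sent up. *)
have US k : k != w0 w -> U k * S k <= eps v * (U (w0 w) * S (w0 w)).
  move=> kw; rewrite (@le_trans _ _ (bf_up w * \prod_(c <- children d w | c != v) bf c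
      * (U (w0 w) * S (w0 w))))//.
    rewrite mulrACA; apply: ler_pM => //; first exact: Uw.
    rewrite /S -big_split big_seq_cond [leRHS]big_seq_cond; apply: ler_prod => c /andP[cw _].
    by rewrite bmass_ge0//=; exact: bmass_ratio.
  rewrite ler_wpM2r ?mulr_ge0// -(ler_pM2r (bf_gt0 v)).
  rewrite (le_trans _ (le_trans (bf_full w) _))//.
    by rewrite [in leRHS](bigD1_seq v) ?uniq_children//= -mulrA [X in _ * X]mulrC.
  by rewrite (le_trans (bf_full_le v))// ler_wpM2r// ler_piMl.
have US0 k : 0 <= U k * S k by rewrite mulr_ge0.
pose V j := \sum_k a v k j * (U k * S k).
have V0 j : 0 <= V j by apply: sumr_ge0 => k _; rewrite !mulr_ge0.
have pv : parent d v = w by [].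
have v0 : (val v == [::]) = false by case: (val v) vm.
exists V; split=> //.
- apply: lt_le_trans (edge_sum_ge (fun j k => a v k j) y (w0 v) (w0 w)
      (fun j k => a_ge v k j) y_gt0 (fun k => U k * S k) US0).
  by rewrite !mulr_gt0.
- move=> j jv; rewrite /bf_up v0 /bf pv edge_factorC.
  apply: (edge_ratio (fun j k => a v k j) x y (w0 v) (w0 w) (fun j k => a_le1 v k j)
    (a_diag v) _ (fun j k => a_ge v k j) y_gt0 x_ge0 x_le1 (fun k => U k * S k) US0) => //.
  + by move=> k l kl; rewrite a_off// eq_sym.
  + by move=> k kw; rewrite edge_epsC -pv; exact: US.
- move=> f fv; rewrite UE; last first.
    move=> u wu; apply: fv; apply: contra wu => vu.
    by case: (below_child _ _ _ vw vu).
  rewrite Mm; under eq_bigr do rewrite nodeS.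
  transitivity (\sum_k \sum_j a v k j * (U k * S k) * node a w0 n v j f (upd w0 v j)).
    apply: eq_bigr => k _.
    rewrite (branches_single n k w v)//; [|exact: uniq_children].
    rewrite mulr_sumr mulr_sumr; apply: eq_bigr => j _.
    have wv : w != v by apply/eqP => wv; move: wm; rewrite wv vm => /esym/n_Sn.
    rewrite updC// (node_indep _ _ n v j w f); first by rewrite /S; ring.
    apply: fv; apply: contra wv => /below_size; rewrite wm vm ltnn.
    by [].
  by rewrite exchange_big; apply: eq_bigr => j _; rewrite /V mulr_suml.
Qed.

(** The messages from the parent and from all children meet at [v], so [bf_full] bounds the weight
    of each deviating spin against that of [w0 v]; summing over the spins costs [Q]. *)
Lemma root_sum_deviation M v : (size (val v) <= M)%N ->
  root_sum M (fun s => (s v != w0 v)%:R) <= Q * Z * root_sum M (fun=> 1).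
Proof.
move=> vM; have [U [U0 U1 UB UE]] := up_message M v vM.
have nE : (M.+1 - size (val v) = (M - size (val v)).+1)%N by rewrite subSn.
set n := (M.+1 - _)%N in nE UE *.
have nd k := node_pos_op a w0 a_ge0 n v k.
rewrite !UE//; last first.
  move=> u vu s k; rewrite upd_neq//; apply: contraNneq vu => <-; exact: below_refl.
have -> : \sum_k U k * node a w0 n v k (fun=> 1) (upd w0 v k) = \sum_k U k * mass a w0 n v k.
  by apply: eq_bigr => k _; case: (nd k) => _ _ ->.
have nE1 k : node a w0 n v k (fun s => (s v != w0 v)%:R) (upd w0 v k) =
    (k != w0 v)%:R * mass a w0 n v k.
  rewrite node_mass//; first by rewrite upd_same.
  by move=> u vu sz s l; rewrite upd_neq//; apply: contraTneq sz => ->; rewrite ltnn.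
under eq_bigr do rewrite nE1.
have Um0 : 0 <= U (w0 v) * mass a w0 n v (w0 v) by rewrite mulr_ge0 ?mass_ge0.
rewrite (@le_trans _ _ (\sum_(k : spin q) Z * (U (w0 v) * mass a w0 n v (w0 v))))//; last first.
  rewrite sumr_const -[leLHS]mulr_natl mulrA; apply: ler_wpM2l; first exact: mulr_ge0.
  rewrite (bigD1 (w0 v))//= lerDl sumr_ge0// => k _.
  by rewrite mulr_ge0// mass_ge0.
apply: ler_sum => k _; have [_|kv] := eqVneq k (w0 v).
  by rewrite mul0r mulr0 mulr_ge0.
rewrite mul1r (@le_trans _ _ ((bf_up v * U (w0 v)) *
    ((\prod_(c <- children d v) bf c) * mass a w0 n v (w0 v))))//.
  apply: ler_pM => //; [exact: mass_ge0|exact: UB|].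
  rewrite nE !massS -big_split big_seq [leRHS]big_seq; apply: ler_prod => c cv.
  by rewrite bmass_ge0//=; exact: bmass_ratio.
rewrite mulrACA ler_wpM2r// (le_trans (bf_full v))// ler_piMr// exprn_ile1// ltW//.
Qed.

(** * Decay of the influence of a spin on far observables *)

Let th := d.+1%:R * (1 + Q) * Z.

Let th_ge0 : 0 <= th. Proof. exact: mulr_ge0 (mulr_ge0 (ler0n _ _) (addr_ge0 ler01 Q_ge0)) Z_ge0. Qed.

(** One generation costs [1 + Q] by [edge_perturb] and at most [d.+1] by telescoping over the
    children, and gains [Z] by [bf_children]; the product is [th]. The constant 2 comes from
    bounding both terms trivially at [i = 0]. Weighting the difference by the mass at [k] yields the
    factor [eps w], which is the form that [edge_perturb] takes as input one generation higher. *)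
Lemma spin_influence N i n w h H : (size (val w) + i)%N = N ->
  (forall s, `|h s| <= H) -> sum_lt N h -> forall s k, k != w0 w ->
  `|node a w0 n w k h (upd s w k) -
    mass a w0 n w k / mass a w0 n w (w0 w) * node a w0 n w (w0 w) h (upd s w (w0 w))|
  <= eps w * (2 * th ^+ i) * mass a w0 n w (w0 w) * H.
Proof.
elim: i n w h H => [|i IHi] n w h H wN hH hN s k kw.
  have H0 := le_trans (normr_ge0 _) (hH w0).
  have m0 := mass_gt0 n w.
  rewrite (le_trans (ler_normB _ _))// normrM [`|_ / _|]ger0_norm ?divr_ge0 ?mass_ge0//.
  have nk j := pos_op_norm _ _ (node_pos_op a w0 a_ge0 n w j) _ _ hH (upd s w j).
  rewrite (@le_trans _ _ (2 * (H * mass a w0 n w k)))//.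
    rewrite [leRHS]mulrDl mul1r lerD//.
    rewrite (le_trans (ler_wpM2l _ (nk (w0 w))))// ?divr_ge0 ?mass_ge0//.
    by rewrite [leLHS](_ : _ = H * mass a w0 n w k)//; field; rewrite gt_eqF.
  have := mass_box1 n w k kw; move: (mass a w0 n w k) (mass a w0 n w (w0 w)) => u t ut.
  have -> : eps w * (2 * th ^+ 0) * t * H = 2 * (H * (eps w * t)) by rewrite expr0; ring.
  by rewrite ler_wpM2l// ler_wpM2l.
have H0 := le_trans (normr_ge0 _) (hH w0).
have wN1 : (size (val w) < N)%N by rewrite -wN addnS ltnS leq_addr.
(* A frozen vertex gives both terms weight 0, as [k != w0 w]. *)
case: n => [|n].
  rewrite /= (negbTE kw) !mul0r subrr normr0.
  by rewrite !mulr_ge0// exprn_ge0.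
(* The generation of [w] precedes [N], so [h] does not see the spin at [w] and both terms may be
   taken at the same [s]. *)
have nw j l : node a w0 n.+1 w j h (upd s w l) = node a w0 n.+1 w j h s.
  by apply: node_indep; apply: hN.
rewrite !nw !nodeS !massS.
have -> : \prod_(c <- children d w) bmass a w0 n c k /
     \prod_(c <- children d w) bmass a w0 n c (w0 w) =
   \prod_(c <- children d w) (bmass a w0 n c k / bmass a w0 n c (w0 w)).
  by rewrite prodf_div.
set m0 := \prod_(c <- _) bmass a w0 n c (w0 w).
have m00 : 0 <= m0 by rewrite prodr_ge0// => c _; exact: bmass_ge0.
have ti : 0 <= th ^+ i by rewrite exprn_ge0.
have Q1 : 0 <= 1 + Q by rewrite addr_ge0.
have POB c g G : c \in children d w -> sum_lt N g -> (forall s, `|g s| <= G) ->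
    forall s, `|branch a w0 n c k g s -
      bmass a w0 n c k / bmass a w0 n c (w0 w) * branch a w0 n c (w0 w) g s|
    <= (1 + Q) * (2 * th ^+ i) * bf c * bmass a w0 n c (w0 w) * G.
  move=> cw gN gG t.
  have cN : (size (val c) + i)%N = N by rewrite (size_child _ _ cw) addSnnS.
  have pc := parent_child _ _ cw.
  have G0 := le_trans (normr_ge0 _) (gG w0).
  rewrite (le_trans (edge_perturb (a c) x y (w0 w) (w0 c) (a_le1 c) (a_diag c) (a_off c)
    (a_ge c) y_gt0 x_ge0 x_le1 (mass a w0 n c) (mass_ge0 _ _ a_ge0 _ _) _
    (fun j => node a w0 n c j g (upd t c j)) (2 * th ^+ i * G) k _ (mass_gt0 _ _) kw _))//.
  + by move=> j jc; have := mass_box1 n c j jc; rewrite /eps pc.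
  + by rewrite !mulr_ge0.
  + move=> j jc; have := IHi n c g G cN gG gN t j jc; rewrite /eps pc => /le_trans; apply.
    by rewrite le_eqVlt; apply/orP; left; apply/eqP; ring.
  + rewrite /bf pc -/(bmass a w0 n c (w0 w)).
    by rewrite le_eqVlt; apply/orP; left; apply/eqP; rewrite -/Q; ring.
rewrite (le_trans (telescope (fun c => branch a w0 n c k) (fun c => branch a w0 n c (w0 w))
  (fun c => bmass a w0 n c k) (fun c => bmass a w0 n c (w0 w)) bf (sum_lt N)
  ((1 + Q) * (2 * th ^+ i)) (children d w) _ _ _ _ _ _ _ POB h H hN hH s))//.
- by rewrite !mulr_ge0.
- by move=> c _; exact: branch_pos_op.
- by move=> c _; exact: branch_pos_op.
- by move=> c cw; exact: bmass_gt0.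
- by move=> c cw; exact: bmass_ratio.
- by move=> c g _ gN v vN; apply: branch_indep; exact: gN.
- have -> : eps w * (2 * th ^+ i.+1) * m0 * H =
      (d.+1%:R * ((1 + Q) * (2 * th ^+ i)) * (Z * eps w)) * (m0 * H).
    by rewrite exprS /th; ring.
  rewrite -mulrA ler_wpM2r ?mulr_ge0//.
  apply: ler_pM; rewrite ?mulr_ge0 ?prodr_ge0//; last exact: bf_children.
  by rewrite ler_wpM2r ?mulr_ge0// ler_nat size_children_le.
Qed.

(** * Decorrelation of near and far observables *)

Let K := d.+1%:R * (Q / y) ^+ d.+2.

Let Qy_ge1 : 1 <= Q / y.
Proof. by rewrite ler_pdivlMr// mul1r (le_trans y_le1). Qed.

Let Qy_ge0 : 0 <= Q / y. Proof. exact: le_trans Qy_ge1. Qed.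

Let K_ge0 : 0 <= K. Proof. by rewrite mulr_ge0// exprn_ge0. Qed.

Definition sum_le L (f : config d q -> R) :=
  forall v, (L < size (val v))%N -> indep v f.

(* Up to [kap], summing over the spins below [w] acts on a function [h] of the
   far spins independently of the near observable [f] and of the spin at [w]. *)
Definition factorizes L N (op : spin q -> (config d q -> R) -> config d q -> R) kap :=
  forall h H, (forall s, `|h s| <= H) -> sum_lt N h ->
  exists h', [/\ forall s, `|h' s| <= H, sum_lt N h' &
    forall f F, (forall s, `|f s| <= F) -> sum_le L f -> forall s k,
      `|op k (fun s => f s * h s) s - op k f s * h' s| <= kap * F * H].

(** The errors for the [Q] spins at [c] add up, and [bmass_ge] converts the mass at [c] into that of
    the branch at the price [1 / y]. *)
Lemma branch_factorizes L N n w c kap : 0 <= kap -> c \in children d w ->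
  factorizes L N (fun j f s => node a w0 n c j f (upd s c j)) (kap * mass a w0 n c (w0 c)) ->
  factorizes L N (branch a w0 n c) (Q / y * kap * bmass a w0 n c (w0 w)).
Proof.
move=> kap0 cw fac h H hH hN; have [h' [h'H h'N fh]] := fac h H hH hN.
exists h'; split=> // f F fF fL s k.
have F0 := le_trans (normr_ge0 _) (fF s); have H0 := le_trans (normr_ge0 _) (hH s).
rewrite /branch mulr_suml -sumrB (le_trans (ler_norm_sum _ _ _))//.
rewrite (@le_trans _ _ (\sum_(j : spin q) kap * mass a w0 n c (w0 c) * F * H))//.
  apply: ler_sum => j _; rewrite -mulrA -mulrBr normrM (ger0_norm (a_ge0 _ _ _)).
  by rewrite -[leRHS]mul1r ler_pM// fh.
rewrite sumr_const -[leLHS]mulr_natl -/Q.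
have -> : Q / y * kap * bmass a w0 n c (w0 w) * F * H =
  (Q * kap * F * H) * (y^-1 * bmass a w0 n c (w0 w)) by ring.
have -> : Q * (kap * mass a w0 n c (w0 c) * F * H) =
  (Q * kap * F * H) * mass a w0 n c (w0 c) by ring.
by rewrite ler_wpM2l ?mulr_ge0// ler_pdivlMl// bmass_ge.
Qed.

(** The children act one after the other, each turning the far function left by the previous one
    into a new one. Since [k] is arbitrary, the masses are compared with those at [w0 w] by
    [bmass_ratio_crude]. *)
Lemma branches_factorize L N n w kap (r : seq (vert d)) : 0 <= kap ->
  (forall c, c \in r -> c \in children d w) ->
  (forall c, c \in r -> factorizes L N (branch a w0 n c) (kap * bmass a w0 n c (w0 w))) ->
  factorizes L N (fun k f => foldr (fun c => branch a w0 n c k) f r)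
    ((size r)%:R * kap * \prod_(c <- r) (Q / y * bmass a w0 n c (w0 w))).
Proof.
move=> kap0; elim: r => [|c r IHr] rw fac h H hH hN.
  by exists h; split=> // f F _ _ s k /=; rewrite subrr normr0 !mul0r.
have [h1 [h1H h1N fh1]] := IHr (fun c' c'r => rw c' (mem_behead (c'r : c' \in behead (c :: r))))
  (fun c' c'r => fac c' (mem_behead (c'r : c' \in behead (c :: r)))) h H hH hN.
have cr := mem_head c r.
have [h2 [h2H h2N fh2]] := fac c cr h1 H h1H h1N.
exists h2; split=> // f F fF fL s k.
have F0 := le_trans (normr_ge0 _) (fF s); have H0 := le_trans (normr_ge0 _) (hH s).
pose g := foldr (fun c => branch a w0 n c k) f r.
have gL : sum_le L g.
  by move=> v vL; apply: foldr_indep => [c' g'|]; [exact: branch_indep|exact: fL].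
have gF : forall s, `|g s| <= F * \prod_(c' <- r) bmass a w0 n c' k.
  apply: (pos_op_norm (fun h => foldr (fun c => branch a w0 n c k) h r)) => //.
  by apply: pos_op_foldr => c' _; exact: branch_pos_op.
rewrite big_cons /= -/g.
set b := bmass a w0 n c (w0 w); set Pr := \prod_(c' <- r) (Q / y * _).
have gle : \prod_(c' <- r) bmass a w0 n c' k <= Pr.
  rewrite /Pr big_seq [leRHS]big_seq; apply: ler_prod => c' c'r.
  by rewrite bmass_ge0//= bmass_ratio_crude// rw// inE c'r orbT.
have b0 : 0 <= b by exact: bmass_ge0.
have Pr0 : 0 <= Pr by rewrite prodr_ge0// => c' _; rewrite mulr_ge0// bmass_ge0.
have cpos := branch_pos_op a w0 a_ge0 n c k.
set f1 := foldr _ _ r.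
have -> : branch a w0 n c k f1 s - branch a w0 n c k g s * h2 s =
    branch a w0 n c k (fun t => f1 t - g t * h1 t) s +
    (branch a w0 n c k (fun t => g t * h1 t) s - branch a w0 n c k g s * h2 s).
  by rewrite (pos_opB _ _ cpos); ring.
rewrite (le_trans (ler_normD _ _))//.
have e1 := pos_op_norm _ _ cpos _ _ (fun t => fh1 f F fF fL t k) s.
have e2 := fh2 g _ gF gL s k.
rewrite (le_trans (lerD e1 e2))// -/b -/Pr.
have -> : (size r).+1%:R * kap * (Q / y * b * Pr) * F * H =
  (size r)%:R * kap * Pr * F * H * (Q / y * b) + (kap * F * H * b) * (Q / y * Pr).
  by rewrite -natr1; ring.
have -> : kap * b * (F * \prod_(c' <- r) bmass a w0 n c' k) * H =
  (kap * F * H * b) * \prod_(c' <- r) bmass a w0 n c' k by ring.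
apply: lerD; first by rewrite ler_wpM2l ?mulr_ge0// bmass_ratio_crude// rw.
rewrite ler_wpM2l ?mulr_ge0// (le_trans gle)//.
by rewrite -[leLHS]mul1r ler_wpM2r.
Qed.

(** At generation [L] the near observable is constant below [w], and [spin_influence] allows [h] to
    be replaced by its conditional mean given the spin [w0 w]. Each of the [i] generations above
    costs [K]: [d.+1] for the number of children, [Q / y] for the branch, [(Q / y) ^+ d.+1] for the
    masses. The radius [L] is fixed before [I], so this cost is harmless. *)
Lemma node_factorizes L I i n w : (size (val w) + i)%N = L ->
  factorizes L (L + I) (fun k f s => node a w0 n w k f (upd s w k))
    (K ^+ i * (2 * th ^+ I) * mass a w0 n w (w0 w)).
Proof.
have thI : 0 <= th ^+ I by rewrite exprn_ge0.
elim: i n w => [|i IHi] n w wL h H hH hN; have H0 := le_trans (normr_ge0 _) (hH w0).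
  have m0 := mass_gt0 n w.
  pose h' s := node a w0 n w (w0 w) h (upd s w (w0 w)) / mass a w0 n w (w0 w).
  exists h'; split.
  - move=> s; rewrite /h' normrM [`|_^-1|]ger0_norm ?invr_ge0 ?(ltW m0)// ler_pdivrMr//.
    exact: (pos_op_norm _ _ (node_pos_op a w0 a_ge0 n w (w0 w))).
  - move=> v vN s k; rewrite /h'; congr (_ / _).
    have [->|vw] := eqVneq v w; first by rewrite upd_upd.
    by rewrite updC// node_indep//; exact: hN.
  - move=> f F fF fL s k; have F0 := le_trans (normr_ge0 _) (fF s).
    have fw v : below w v -> (size (val w) < size (val v))%N -> indep v f.
      by move=> _ wv; apply: fL; rewrite -wL addn0.
    rewrite node_pull// [node _ _ _ _ _ f]node_mass// -mulrA -mulrBr normrM.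
    rewrite expr0 mul1r.
    have -> : 2 * th ^+ I * mass a w0 n w (w0 w) * F * H =
      F * (2 * th ^+ I * mass a w0 n w (w0 w) * H) by ring.
    have -> : mass a w0 n w k * h' s = mass a w0 n w k / mass a w0 n w (w0 w) *
        node a w0 n w (w0 w) h (upd s w (w0 w)) by rewrite /h'; ring.
    apply: ler_pM => //; have [->|kw] := eqVneq k (w0 w).
      by rewrite divff ?gt_eqF// mul1r subrr normr0 !mulr_ge0// ltW.
    rewrite (le_trans (spin_influence (L + I) I n w h H _ hH hN s k kw))//.
      by rewrite -wL addn0.
    by rewrite -!mulrA ler_piMl ?mulr_ge0// ltW.
have wN : (size (val w) < L + I)%N by rewrite -wL addnS addSn ltnS -addnA leq_addr.
case: n => [|n].
  (* At depth 0 [node] is a multiplication and [h] does not depend on the spin at [w], so [h] itself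
     serves. *)
  exists h; split=> // f F fF _ s k; have F0 := le_trans (normr_ge0 _) (fF s).
  by rewrite /= (hN w wN) mulrA subrr normr0 !mulr_ge0 ?exprn_ge0.
pose kap := Q / y * (K ^+ i * (2 * th ^+ I)).
have kap0 : 0 <= kap.
  exact: mulr_ge0 Qy_ge0 (mulr_ge0 (exprn_ge0 i K_ge0) (mulr_ge0 (ler0n _ 2) thI)).
have /(_ h H hH hN)[h' [h'H h'N fh]] := branches_factorize L (L + I) n w kap (children d w) kap0
  (fun c cw => cw) (fun c cw => branch_factorizes L (L + I) n w c (K ^+ i * (2 * th ^+ I))
    (mulr_ge0 (exprn_ge0 i K_ge0) (mulr_ge0 (ler0n _ 2) thI)) cw
    (IHi n c (etrans (congr1 (addn^~ i) (size_child _ _ cw)) (etrans (addSnnS _ _) wL)))).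
exists h'; split=> // f F fF fL s k; have F0 := le_trans (normr_ge0 _) (fF s).
rewrite !nodeS -(h'N w wN s k) (le_trans (fh f F fF fL (upd s w k) k))//.
rewrite ler_wpM2r// ler_wpM2r// massS big_split/= big_const_seq count_predT iter_mulr_1.
set m0 := \prod_(c <- _) _.
have m00 : 0 <= m0 by rewrite prodr_ge0// => c _; exact: bmass_ge0.
have -> : K ^+ i.+1 * (2 * th ^+ I) * m0 = d.+1%:R * kap * ((Q / y) ^+ d.+1 * m0).
  by rewrite exprS /kap {1}/K [(Q / y) ^+ d.+2]exprS; ring.
have sd := size_children_le w.
apply: ler_pM; first exact: mulr_ge0.
- by rewrite mulr_ge0 ?exprn_ge0.
- by rewrite ler_wpM2r// ler_nat.
by rewrite ler_wpM2r// ler_weXn2l.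
Qed.

Lemma root_sum_decorrelation M L I f h F H : (forall s, `|f s| <= F) ->
  (forall s, `|h s| <= H) -> sum_le L f -> sum_lt (L + I) h ->
  `|root_sum M (fun s => f s * h s) * root_sum M (fun=> 1) - root_sum M f * root_sum M h|
  <= 2 * Q * (K ^+ L * (2 * th ^+ I)) * F * H * root_sum M (fun=> 1) ^+ 2.
Proof.
move=> fF hH fL hN; pose r := Defs.root d.
have F0 := le_trans (normr_ge0 _) (fF w0); have H0 := le_trans (normr_ge0 _) (hH w0).
have [h' [h'H h'N fh]] := node_factorizes L I L M.+1 r (add0n L) h H hH hN.
set kap := K ^+ L * (2 * th ^+ I) in fh *.
have kap0 : 0 <= kap by rewrite !mulr_ge0 ?exprn_ge0.
have nd k := node_pos_op a w0 a_ge0 M.+1 r k.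
set W1 := root_sum M (fun=> 1); set m0 := mass _ _ _ _ _ in fh.
have m00 : 0 <= m0 by exact: mass_ge0.
have W1E : W1 = \sum_k mass a w0 M.+1 r k.
  by apply: eq_bigr => k _; case: (nd k) => _ _ ->.
have m0W : m0 <= W1.
  rewrite W1E (bigD1 (w0 r))// lerDl sumr_ge0// => k _; exact: mass_ge0.
have W10 : 0 <= W1 by exact: le_trans m0W.
(* The number [h' w0] is the same for all near observables; the instances [g = f] and [g = 1]
   together eliminate it, whence the factor 2 in the conclusion. *)
have key g G : (forall s, `|g s| <= G) -> sum_le L g ->
    `|root_sum M (fun s => g s * h s) - root_sum M g * h' w0| <= Q * kap * G * H * W1.
  move=> gG gL; have G0 := le_trans (normr_ge0 _) (gG w0).
  rewrite /root_sum mulr_suml -sumrB (le_trans (ler_norm_sum _ _ _))//.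
  rewrite (@le_trans _ _ (\sum_(k : spin q) kap * m0 * G * H))//.
    by apply: ler_sum => k _; exact: fh.
  rewrite sumr_const -[leLHS]mulr_natl -/Q.
  have -> : Q * (kap * m0 * G * H) = Q * kap * G * H * m0 by ring.
  by rewrite ler_wpM2l//; exact: mulr_ge0 (mulr_ge0 (mulr_ge0 Q_ge0 kap0) G0) H0.
have e1 := key f F fF fL.
have n1 (s : config d q) : `|1 : R| <= 1 by rewrite normr1.
have := key (fun=> 1) 1 n1 (fun v _ s k => erefl); rewrite -/W1.
have -> : (fun s => 1 * h s) = h by apply: funext => s; rewrite mul1r.
rewrite mulr1 => e2.
have Wf : `|root_sum M f| <= F * W1.
  rewrite /root_sum (le_trans (ler_norm_sum _ _ _))// W1E mulr_sumr; apply: ler_sum => k _.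
  exact: (pos_op_norm _ _ (nd k)).
have -> : root_sum M (fun s => f s * h s) * W1 - root_sum M f * root_sum M h =
    (root_sum M (fun s => f s * h s) - root_sum M f * h' w0) * W1
    - root_sum M f * (root_sum M h - W1 * h' w0) by ring.
rewrite (le_trans (ler_normB _ _))// !normrM (ger0_norm W10).
have -> : 2 * Q * kap * F * H * W1 ^+ 2 =
  Q * kap * F * H * W1 * W1 + (F * W1) * (Q * kap * H * W1) by ring.
by rewrite lerD// ?ler_wpM2r//; apply: ler_pM.
Qed.

End GroundState.

(** * Iterated sums over spins, and local functions *)

Section SpinSums.
Context {R : realType} {d q : nat}.
Implicit Types (f g : config d q -> R) (s : config d q) (v w : vert d)
  (L V : seq (vert d)).

Definition vsum v f s := \sum_k f (upd s v k).

Definition ssum L f := foldr vsum f L.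

Lemma ssum_cat L1 L2 f : ssum (L1 ++ L2) f = ssum L1 (ssum L2 f).
Proof. exact: foldr_cat. Qed.

Lemma vsumC v w f : vsum v (vsum w f) = vsum w (vsum v f).
Proof.
have [->//|vw] := eqVneq v w; apply: funext => s; rewrite /vsum exchange_big /=.
by apply: eq_bigr => k _; apply: eq_bigr => l _; rewrite updC.
Qed.

Lemma ssum_perm L1 L2 f : perm_eq L1 L2 -> ssum L1 f = ssum L2 f.
Proof.
have vsum_ssum v L g : vsum v (ssum L g) = ssum L (vsum v g).
  by elim: L => //= w L IHL; rewrite vsumC IHL.
have ssumC L L' g : ssum L (ssum L' g) = ssum L' (ssum L g).
  by elim: L => //= v L ->; rewrite vsum_ssum.
rewrite perm_sym => L21; pose P L := ssum L f = ssum L2 f.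
apply: (catCA_perm_ind (P := P)) L21 _ => // s1 s2 s3; rewrite /P => <-.
by rewrite !ssum_cat ssumC.
Qed.

Lemma ssum_indep_mem L f v : v \in L -> indep v (ssum L f).
Proof.
elim: L => //= w L IHL; rewrite inE; have [-> _|vw /= vL] := eqVneq v w.
  by move=> s k; apply: eq_bigr => l _; rewrite upd_upd.
by move=> s k; apply: eq_bigr => l _; rewrite updC// IHL.
Qed.

Lemma ssum_pull L f g : (forall v, v \in L -> indep v f) ->
  ssum L (fun s => f s * g s) = fun s => f s * ssum L g s.
Proof.
elim: L => //= v L IHL fL; rewrite IHL; last first.
  by move=> w wL; apply: fL; rewrite inE wL orbT.
apply: funext => s; rewrite /vsum mulr_sumr; apply: eq_bigr => k _.
by rewrite (fL v (mem_head _ _)).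
Qed.

Lemma eq_ssum L f g s : (forall s', (forall v, v \notin L -> s' v = s v) -> f s' = g s') ->
  ssum L f s = ssum L g s.
Proof.
elim: L s => /= [|v L IHL] s fg; first exact: fg.
apply: eq_bigr => k _; apply: IHL => s' ss'; apply: fg => w.
by rewrite inE negb_or => /andP[wv wL]; rewrite ss'// upd_neq.
Qed.

Lemma le_ssum L f g : (forall s, f s <= g s) -> forall s, ssum L f s <= ssum L g s.
Proof.
move=> fg; elim: L => //= v L IHL s; apply: ler_sum => k _; exact: IHL.
Qed.

Lemma ssum_gt0 L f : (forall s, 0 < f s) -> forall s, 0 < ssum L f s.
Proof.
move=> f0; elim: L => //= v L IHL s; rewrite /vsum (bigD1 (s v))//=.
by rewrite ltr_pwDl// sumr_ge0// => k _; exact: ltW.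
Qed.

Lemma ssumD L f g : ssum L (fun s => f s + g s) = fun s => ssum L f s + ssum L g s.
Proof.
elim: L => //= v L ->; apply: funext => s; rewrite /vsum -big_split.
by apply: eq_bigr.
Qed.

Lemma ssumZ L f (c : R) : ssum L (fun s => c * f s) = fun s => c * ssum L f s.
Proof. exact: ssum_pull. Qed.

Definition local V {T : Type} (f : config d q -> T) :=
  forall s s', (forall v, v \in V -> s v = s' v) -> f s = f s'.

Lemma local_sub V V' {T : Type} (f : config d q -> T) :
  {subset V <= V'} -> local V f -> local V' f.
Proof. by move=> VV' fV s s' ss'; apply: fV => v /VV'; exact: ss'. Qed.

Lemma local_indep V f v : v \notin V -> local V f -> indep v f.
Proof. by move=> vV fV s k; apply: fV => w wV; rewrite upd_neq//; apply: contraNneq vV => <-. Qed.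

Lemma local_ssum V L f : local V f -> local V (ssum L f).
Proof.
move=> fV; elim: L => //= v L IHL s s' ss'; apply: eq_bigr => k _.
by apply: IHL => w wV; rewrite /upd; case: eqP => // _; exact: ss'.
Qed.

(** Bridge from the [ffun]-indexed sums of [gamma] to iterated sums; [h] splits an assignment on
    [v :: L] into the spin at [v] and the rest. *)
Lemma ssum_glue L f s : uniq L ->
  \sum_(eta : {ffun 'I_(size L) -> spin q}) f (Defs.glue L eta s) = ssum L f s.
Proof.
elim: L s => [|v L IHL] s /=.
  move=> _; rewrite (bigD1 [ffun=> s (Defs.root d)])//= big1 ?addr0.
    by congr f; apply: funext => v; rewrite /Defs.glue; case: insubP => // -[].
  by move=> eta /eqP[]; apply/ffunP => -[].
move=> /andP[vL uL]; rewrite /vsum.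
pose h (p : spin q * {ffun 'I_(size L) -> spin q}) : {ffun 'I_(size L).+1 -> spin q} :=
  [ffun i => if unlift ord0 i is Some j then p.2 j else p.1].
have h_bij : bijective h.
  exists (fun eta : {ffun 'I_(size L).+1 -> spin q} =>
    (eta ord0, [ffun j : 'I_(size L) => eta (lift ord0 j)])).
    move=> [k eta]; congr pair; first by rewrite ffunE unlift_none.
    by apply/ffunP => j; rewrite !ffunE liftK.
  move=> eta; apply/ffunP => i; rewrite ffunE.
  by case: unliftP => [j|] -> /=; rewrite ?ffunE.
rewrite (reindex h)/=; last exact: onW_bij.
rewrite -(pair_big predT predT (fun k eta => f (Defs.glue (v :: L) (h (k, eta)) s)))/=.
apply: eq_bigr => k _; rewrite -IHL//; apply: eq_bigr => eta _; congr f.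
apply: funext => w; rewrite /Defs.glue /=; have [<-|wv] := eqVneq v w.
  have -> : (insub 0%N : option 'I_(size L).+1) = Some ord0.
    by rewrite -[0%N]/(val (@ord0 (size L))) valK.
  rewrite ffunE unlift_none /=.
  by case: insubP => [i|]; rewrite ?upd_same// index_mem (negbTE vL).
rewrite eq_sym in wv.
case: insubP => [i _ iE|]; case: insubP => [i' _ i'E|] //=.
- have -> : i = lift ord0 i' by apply: val_inj; rewrite /= /bump/= add1n i'E iE.
  by rewrite ffunE liftK.
- by rewrite -ltnS -iE ltn_ord.
- by rewrite ltnS -i'E ltn_ord.
- by move=> _ _; rewrite upd_neq.
Qed.

End SpinSums.

(** * Vertex and edge sets of truncated subtrees and balls *)

Section Volumes.
Context {d : nat}.
Implicit Types v w c : vert d.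

(* The vertices summed by [branch n c] and the edges (indexed by their lower
   endpoint) that it weights. *)
Fixpoint svol n c : seq (vert d) :=
  if n is n'.+1 then c :: flatten (map (svol n') (children d c)) else [::].

Fixpoint evol n c : seq (vert d) :=
  if n is n'.+1 then c :: flatten (map (evol n') (children d c)) else [:: c].

Lemma below_child_ex w v : below w v -> v != w -> exists2 c, c \in children d w & below c v.
Proof.
move=> /prefixP[[|a t] vE]; first by rewrite cats0 in vE; rewrite (val_inj vE) eqxx.
move=> _; have ca : sorted (fun a b => a != b) (rcons (val w) a).
  have := take_sorted (size (val w)).+1 (valP v); rewrite vE take_cat ltnNge leqnSn/=.
  by rewrite subSnn /= take0 cats1.
exists (exist _ (rcons (val w) a) ca); first by apply/mem_childrenP; exists a.
by apply/prefixP; exists t; rewrite vE /= cat_rcons.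
Qed.

Lemma below_parent c v : below c v -> v != c -> below c (parent d v).
Proof.
move=> cv vc; have [c' c'c c'v] := below_child_ex _ _ cv vc.
have [-> | vc'] := eqVneq v c'; first by rewrite (parent_child _ _ c'c) below_refl.
move: cv c'v; rewrite /below !prefixE val_parent => /eqP cv /eqP c'v.
have c'sz := size_child _ _ c'c.
have c'lt : (size (val c') < size (val v))%N.
  rewrite ltn_neqAle; apply/andP; split; last by rewrite -c'v size_take; case: ltnP => // /ltnW.
  apply: contra vc' => /eqP sz; apply/eqP/val_inj.
  by rewrite -c'v sz take_size.
by rewrite take_takel ?cv//; move: c'lt; rewrite c'sz; case: (size (val v)) => //= m /ltnW.
Qed.

Lemma mem_svol n c v :
  (v \in svol n c) = below c v && (size (val v) < size (val c) + n)%N.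
Proof.
elim: n c v => [|n IHn] c v.
  by rewrite addn0 in_nil; apply/esym/negP => /andP[/below_size]; rewrite leqNgt => /negP.
rewrite /= inE; have [->|vc] := eqVneq v c.
  by rewrite below_refl /= addnS ltnS leq_addr.
rewrite /=; apply/flatten_mapP/andP => [[c' c'c]|[cv sz]].
  rewrite IHn => /andP[c'v sz]; have [? _] := below_child _ _ _ c'c c'v.
  by split=> //; rewrite addnS -addSn -(size_child _ _ c'c).
have [c' c'c c'v] := below_child_ex _ _ cv vc; exists c' => //.
by rewrite IHn c'v (size_child _ _ c'c) addSn -addnS.
Qed.

Lemma mem_evol n c v :
  (v \in evol n c) = below c v && (size (val v) <= size (val c) + n)%N.
Proof.
elim: n c v => [|n IHn] c v.
  rewrite /= addn0 inE; have [->|vc] := eqVneq v c; first by rewrite below_refl leqnn.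
  apply/esym/negP => /andP[cv]; have [c' c'c c'v] := below_child_ex _ _ cv vc.
  by have [_] := below_child _ _ _ c'c c'v; rewrite ltnNge => /negP.
rewrite /= inE; have [->|vc] := eqVneq v c; first by rewrite below_refl /= leq_addr.
rewrite /=; apply/flatten_mapP/andP => [[c' c'c]|[cv sz]].
  rewrite IHn => /andP[c'v sz]; have [? _] := below_child _ _ _ c'c c'v.
  by split=> //; rewrite addnS -addSn -(size_child _ _ c'c).
have [c' c'c c'v] := below_child_ex _ _ cv vc; exists c' => //.
by rewrite IHn c'v (size_child _ _ c'c) addSn -addnS.
Qed.

Lemma uniq_flatten_children (F : vert d -> seq (vert d)) w (r : seq (vert d)) :
  uniq r -> {subset r <= children d w} -> (forall c, uniq (F c)) ->
  (forall c v, v \in F c -> below c v) -> uniq (flatten (map F r)).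
Proof.
move=> + + uF Fb; elim: r => //= c r IHr /andP[cr ur] rw.
rewrite cat_uniq uF IHr// ?andbT/=; last by move=> v vr; apply: rw; rewrite inE vr orbT.
apply/hasPn => v /flatten_mapP[c' c'r /Fb c'v]; apply/negP => /Fb.
apply/negP; apply: (below_children_disjoint w c' c) c'v.
- by apply: rw; rewrite inE c'r orbT.
- by apply: rw; rewrite mem_head.
- by apply: contraNneq cr => <-.
Qed.

Lemma uniq_svol n c : uniq (svol n c).
Proof.
elim: n c => //= n IHn c; apply/andP; split.
  apply/flatten_mapP => -[c' c'c]; rewrite mem_svol => /andP[c'cb _].
  by have [_] := below_child _ _ _ c'c c'cb; rewrite ltnn.
apply: (uniq_flatten_children _ c) => //; first exact: uniq_children.
by move=> c' v; rewrite mem_svol => /andP[].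
Qed.

Lemma uniq_evol n c : uniq (evol n c).
Proof.
elim: n c => //= n IHn c; apply/andP; split.
  apply/flatten_mapP => -[c' c'c]; rewrite mem_evol => /andP[c'cb _].
  by have [_] := below_child _ _ _ c'c c'cb; rewrite ltnn.
apply: (uniq_flatten_children _ c) => //; first exact: uniq_children.
by move=> c' v; rewrite mem_evol => /andP[].
Qed.

(** [svol] counts generations, the root included, whence the shift from the radius. *)
Definition ball n := svol n.+1 (Defs.root d).

Definition ball_edges n := flatten (map (evol n) (children d (Defs.root d))).

Lemma mem_ball n v : (v \in ball n) = (size (val v) <= n)%N.
Proof. by rewrite mem_svol /below prefix0s. Qed.

Lemma mem_ball_edges n v : (v \in ball_edges n) = (val v != [::]) && (size (val v) <= n.+1)%N.
Proof.
apply/flatten_mapP/andP => [[c cr]|[v0 vn]].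
  rewrite mem_evol (size_child _ _ cr) => /andP[cv sz]; split=> //.
  by have [_] := below_child _ _ _ cr cv; case: (val v).
have [||c cr cv] := below_child_ex (Defs.root d) v; first by rewrite /below prefix0s.
  by apply: contra v0 => /eqP ->.
by exists c => //; rewrite mem_evol cv (size_child _ _ cr).
Qed.

Lemma uniq_ball_edges n : uniq (ball_edges n).
Proof.
apply: (uniq_flatten_children _ (Defs.root d)) => //.
- exact: uniq_children.
- exact: uniq_evol.
- by move=> c v; rewrite mem_evol => /andP[].
Qed.

Lemma mem_edges_meeting (L : seq (vert d)) v : (v \in edges_meeting L) =
  (val v != [::]) && ((v \in L) || (parent d v \in L)).
Proof.
rewrite /edges_meeting mem_undup mem_filter; case: (eqVneq (val v) [::]) => //= v0.
rewrite mem_cat; congr orb; apply/flatten_mapP/idP => [[w wL vw]|vL].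
  by rewrite (parent_child _ _ vw).
by exists (parent d v) => //; rewrite mem_children v0 eqxx.
Qed.

End Volumes.

(** * Finite-volume Gibbs kernels and their consistency *)

Section FiniteVolume.
Context {R : realType} {d q : nat}.
Variables (a : vert d -> spin q -> spin q -> R) (w0 : config d q).
Hypothesis a_gt0 : forall w k l, 0 < a w k l.
Implicit Types (f g : config d q -> R) (s : config d q) (L E : seq (vert d)).

Definition wedge v s := a v (s (parent d v)) (s v).

Definition wprod E s := \prod_(v <- E) wedge v s.

(* The finite-volume Gibbs kernel acting on functions. *)
Definition gam L f s :=
  ssum L (fun s => f s * wprod (edges_meeting L) s) s /
  ssum L (wprod (edges_meeting L)) s.

Lemma wprod_gt0 E s : 0 < wprod E s.
Proof. by apply: prodr_gt0 => v _; exact: a_gt0. Qed.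

Lemma wedge_indep v x : x != v -> x != parent d v -> indep x (wedge v).
Proof. by move=> xv xp s k; rewrite /wedge !upd_neq// eq_sym. Qed.

Lemma wprod_indep E x : (forall v, v \in E -> x != v /\ x != parent d v) -> indep x (wprod E).
Proof.
move=> xE s k; rewrite /wprod big_seq [RHS]big_seq; apply: eq_bigr => v vE.
by have [xv xp] := xE v vE; exact: wedge_indep.
Qed.

(** Sums over disjoint subtrees merge into one, because the edge weights of one branch do not
    involve the spins summed in another. The formula for a single branch is a hypothesis, supplied
    by the induction of [branch_ssum]. *)
Lemma branches_ssum_of_branch n w j f (r : seq (vert d)) s :
  (forall c g s', c \in r -> s' w = j ->
    (forall x, x \in evol n c -> x \notin svol n c -> s' x = w0 x) ->
    branch a w0 n c j g s' = ssum (svol n c) (fun s => g s * wprod (evol n c) s) s') ->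
  uniq r -> {subset r <= children d w} -> s w = j ->
  (forall c x, c \in r -> x \in evol n c -> x \notin svol n c -> s x = w0 x) ->
  foldr (fun c => branch a w0 n c j) f r s =
  ssum (flatten (map (svol n) r)) (fun s => f s * wprod (flatten (map (evol n) r)) s) s.
Proof.
elim: r s => [|c r IHr] s.
  by move=> *; rewrite /= /wprod big_nil mulr1.
move=> Br /= /andP[cr ur] rw sw bd.
have rw' : {subset r <= children d w} by move=> v vr; apply: rw; rewrite inE vr orbT.
have cw : c \in children d w by apply: rw; rewrite mem_head.
have disj c' x x' : c' \in r -> below c x -> below c' x' -> x != x'.
  move=> c'r cx c'x'; apply: contraTneq c'x' => <-.
  apply: (below_children_disjoint w c c') cx => //; first exact: rw'.
  by apply: contraNneq cr => ->.
rewrite Br ?mem_head//; last by move=> x; apply: bd; rewrite mem_head.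
rewrite ssum_cat; apply: eq_ssum => s' ss'.
have nb c' x : c' \in r -> below c' x -> s' x = s x.
  move=> c'r c'x; apply: ss'; rewrite mem_svol; apply/negP => /andP[cx _].
  by have := disj _ _ _ c'r cx c'x; rewrite eqxx.
rewrite IHr//; first last.
- move=> c' x c'r xe xs; rewrite (nb c')//; last by move: xe; rewrite mem_evol => /andP[].
  by apply: (bd c') => //; rewrite inE c'r orbT.
- rewrite ss'// mem_svol; apply/negP => /andP[cw' _].
  by have [_] := below_child _ _ _ cw cw'; rewrite ltnn.
- by move=> c' g t c'r; apply: Br; rewrite inE c'r orbT.
rewrite mulrC -[LHS](congr1 (@^~ s') (ssum_pull _ _ _ _)).
  congr (ssum _ _ _); apply: funext => t; rewrite /wprod big_cat/=; ring.
move=> x /flatten_mapP[c' c'r]; rewrite mem_svol => /andP[c'x _].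
apply: wprod_indep => v; rewrite mem_evol => /andP[cv _]; split.
  by rewrite eq_sym (disj c').
have [->|vc] := eqVneq v c.
  rewrite (parent_child _ _ cw); apply: contraTneq c'x => ->; apply/negP => c'w.
  by have [_] := below_child _ _ _ (rw' _ c'r) c'w; rewrite ltnn.
by rewrite eq_sym (disj c')// below_parent.
Qed.

Lemma branch_ssum n w c f s : c \in children d w ->
  (forall x, x \in evol n c -> x \notin svol n c -> s x = w0 x) ->
  branch a w0 n c (s w) f s = ssum (svol n c) (fun s => f s * wprod (evol n c) s) s.
Proof.
elim: n w c f s => [|n IHn] w c f s cw bd.
  have sc : s c = w0 c by apply: bd; rewrite ?inE.
  rewrite /branch (bigD1 (s c))//= sc eqxx -[in upd _ _ _]sc upd_id mul1r big1 ?addr0.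
    by rewrite /wprod big_seq1 /wedge (parent_child _ _ cw) sc mulrC.
  by move=> i /negbTE ->; rewrite mul0r mulr0.
have wc : w != c by apply/eqP => wc; have := size_child _ _ cw; rewrite wc => /n_Sn.
rewrite /branch /= /vsum; apply: eq_bigr => i _; set s' := upd s c i.
rewrite -/(branch a w0) (branches_ssum_of_branch n c i f (children d c))//.
- rewrite -[LHS](congr1 (@^~ s') (ssum_pull _ (fun=> a c (s w) i) _ _))//.
  apply: eq_ssum => t ts'; rewrite [wprod (_ :: _) _]big_cons /wedge (parent_child _ _ cw).
  have notin x : (size (val x) <= size (val c))%N -> x \notin flatten [seq svol n i | i <- children d c].
    move=> xc; apply/flatten_mapP => -[c' c'c]; rewrite mem_svol => /andP[c'x _].
    by have [_] := below_child _ _ _ c'c c'x; rewrite ltnNge xc.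
  rewrite !ts' ?notin// ?(size_child _ _ cw)// /s' upd_same upd_neq// /wprod; ring.
- by move=> c' g t c'c <- bd'; exact: IHn.
- exact: uniq_children.
- by rewrite /s' upd_same.
- move=> c' x c'c xe xs; have := xe; rewrite mem_evol => /andP[c'x _].
  have [cx sz] := below_child _ _ _ c'c c'x.
  have xc : x != c by apply: contraTneq sz => ->; rewrite ltnn.
  rewrite /s' upd_neq//; apply: bd; rewrite /= inE.
    by apply/orP; right; apply/flatten_mapP; exists c'.
  rewrite negb_or xc; apply/flatten_mapP => -[c'' c''c xs''].
  have [c''c'|] := eqVneq c' c''; first by rewrite c''c' xs'' in xs.
  move=> /(below_children_disjoint _ _ _ _ c'c c''c)/(_ c'x)/negP; apply.
  by move: xs''; rewrite mem_svol => /andP[].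
Qed.

Lemma root_sum_ssum M f :
  root_sum a w0 M f = ssum (ball M) (fun s => f s * wprod (ball_edges M) s) w0.
Proof.
apply: eq_bigr => k _; rewrite nodeS (branches_ssum_of_branch M (Defs.root d))//.
- by move=> c g s cr <-; exact: branch_ssum.
- exact: uniq_children.
- move=> c x cr; rewrite mem_evol => /andP[cx _] _; rewrite upd_neq//.
  have [_] := below_child _ _ _ cr cx.
  by apply: contraTneq => ->; rewrite ltnn.
Qed.

Lemma gam_indep L f v : v \in L -> indep v (gam L f).
Proof. by move=> vL s k; rewrite /gam !(ssum_indep_mem L _ v vL). Qed.

Lemma gam_pull L f g : (forall v, v \in L -> indep v f) ->
  gam L (fun s => f s * g s) = fun s => f s * gam L g s.
Proof.
move=> fL; apply: funext => s; rewrite /gam mulrA -[f s * _](congr1 (@^~ s) (ssum_pull _ _ _ fL)).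
by congr (ssum _ _ _ / _); apply: funext => t; rewrite mulrA.
Qed.

Lemma gamD L f g : gam L (fun s => f s + g s) = fun s => gam L f s + gam L g s.
Proof.
apply: funext => s; rewrite /gam -mulrDl -[X in _ = X / _](congr1 (@^~ s) (ssumD _ _ _)).
by congr (ssum _ _ _ / _); apply: funext => t; rewrite mulrDl.
Qed.

Lemma gam_den_gt0 L s : 0 < ssum L (wprod (edges_meeting L)) s.
Proof. by apply: ssum_gt0 => t; exact: wprod_gt0. Qed.

Lemma gam1 L : gam L (fun=> 1) = fun=> 1.
Proof.
apply: funext => s; rewrite /gam -[RHS](@divff _ (ssum L (wprod (edges_meeting L)) s)).
  by congr (ssum _ _ _ / _); apply: funext => t; rewrite mul1r.
by rewrite gt_eqF// gam_den_gt0.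
Qed.

Lemma gam_le L f g : (forall s, f s <= g s) -> forall s, gam L f s <= gam L g s.
Proof.
move=> fg s; apply: ler_wpM2r; first by rewrite invr_ge0 ltW// gam_den_gt0.
by apply: le_ssum => t; rewrite ler_wpM2r// ltW// wprod_gt0.
Qed.

Lemma gam_cst L (c : R) : gam L (fun=> c) = fun=> c.
Proof.
have := gam_pull L (fun=> c) (fun=> 1) (fun _ _ _ _ => erefl); rewrite gam1.
have -> : (fun s : config d q => c * 1) = (fun=> c) by apply: funext => s; rewrite mulr1.
by [].
Qed.

Lemma gam_bounds L f (x y : R) : (forall s, x <= f s <= y) -> forall s, x <= gam L f s <= y.
Proof.
move=> fxy s; have cst c : gam L (fun=> c) s = c by rewrite gam_cst.
rewrite -{1}(cst x) -[X in _ && (_ <= X)](cst y).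
by apply/andP; split; apply: gam_le => t; case/andP: (fxy t).
Qed.

Lemma local_wprod E : local (E ++ map (parent d) E) (wprod E).
Proof.
move=> s s' ss'; rewrite /wprod big_seq [RHS]big_seq; apply: eq_bigr => v vE.
by rewrite /wedge !ss'// mem_cat ?vE// map_f ?orbT.
Qed.

Lemma local_gam V L f : local V f ->
  local (V ++ edges_meeting L ++ map (parent d) (edges_meeting L)) (gam L f).
Proof.
move=> fV; have EL := local_wprod (edges_meeting L).
have EL' := local_sub _ (V ++ edges_meeting L ++ map (parent d) (edges_meeting L)) _
  (fun v vE => etrans (mem_cat _ _ _) (introT orP (or_intror vE))) EL.
have fV' := local_sub _ (V ++ edges_meeting L ++ map (parent d) (edges_meeting L)) _
  (fun v vV => etrans (mem_cat _ _ _) (introT orP (or_introl vV))) fV.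
move=> s s' ss'; rewrite /gam; congr (_ / _); last exact: (local_ssum _ _ _ EL').
apply: (local_ssum _ L _ _ _ _ ss') => t t' tt'.
by rewrite (fV' _ _ tt') (EL' _ _ tt').
Qed.

(* Finite-volume consistency: the weight of the ball factors into the part
   meeting [L] and a part not depending on the spins in [L]. *)
Lemma root_sum_gam M L f : uniq L -> (forall v, v \in L -> (size (val v) <= M)%N) ->
  root_sum a w0 M (gam L f) = root_sum a w0 M f.
Proof.
move=> uL LM; rewrite !root_sum_ssum.
have BL : perm_eq (ball M) ([seq v <- ball M | v \notin L] ++ L).
  apply: uniq_perm; first exact: uniq_svol.
    rewrite cat_uniq filter_uniq ?uniq_svol// uL andbT.
    by apply/hasPn => v vL; rewrite mem_filter vL.
  move=> v; rewrite mem_cat mem_filter; case: (boolP (v \in L)) => [vL|_] /=.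
    by rewrite mem_ball LM.
  by rewrite orbF.
rewrite !(ssum_perm _ _ _ BL) !ssum_cat; congr (ssum _ _ _); apply: funext => s.
pose rest s := \prod_(v <- ball_edges M | v \notin edges_meeting L) wedge v s.
have wE t : wprod (ball_edges M) t = rest t * wprod (edges_meeting L) t.
  rewrite /wprod (bigID (fun v => v \in edges_meeting L))/= mulrC; congr (_ * _).
  rewrite -big_filter; apply: perm_big; apply: uniq_perm; rewrite ?filter_uniq ?uniq_ball_edges//.
    exact: undup_uniq.
  move=> v; rewrite mem_filter andb_idr// mem_edges_meeting mem_ball_edges.
  move=> /andP[-> /orP[/LM/leqW//|/LM]]; rewrite val_parent size_takel ?leq_pred//.
  by case: (size (val v)).
have rL v : v \in L -> indep v rest.
  move=> vL t k; rewrite /rest big_seq_cond [RHS]big_seq_cond; apply: eq_bigr => x /andP[xB xE].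
  move: xB xE; rewrite mem_ball_edges mem_edges_meeting => /andP[x0 _].
  rewrite x0 negb_or => /andP[xL pL]; apply: wedge_indep; last by apply: contraNneq pL => <-.
  by apply: contraNneq xL => <-.
have pull g t : ssum L (fun s => g s * wprod (ball_edges M) s) t =
    rest t * ssum L (fun s => g s * wprod (edges_meeting L) s) t.
  rewrite -[RHS](congr1 (@^~ t) (ssum_pull _ _ _ rL)); congr (ssum _ _ _).
  by apply: funext => t'; rewrite wE mulrCA.
rewrite !pull; congr (_ * _).
rewrite [LHS](congr1 (@^~ s) (ssum_pull _ _ _ (gam_indep L f))) /gam.
by rewrite divfK// gt_eqF// gam_den_gt0.
Qed.

End FiniteVolume.

(** * Measurability and integration of local functions *)

Section LocalFunctions.
Context {R : realType} {d q : nat}.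
Implicit Types (V : seq (vert d)) (A B : set (Omega d q)) (f : config d q -> R).

Lemma measurable_spin_at (v : vert d) (k : spin q) :
  measurable ([set s | s v = k] : set (Omega d q)).
Proof. by apply: sub_sigma_algebra; exists v, k. Qed.

Definition local_set V A := forall s s' : config d q,
  (forall v, v \in V -> s v = s' v) -> A s -> A s'.

Lemma local_setI V V' A B : local_set V A -> local_set V' B -> local_set (V ++ V') (A `&` B).
Proof.
move=> AV BV' s s' ss' [As Bs]; split; [apply: AV As|apply: BV' Bs] => v vV; apply: ss'.
  by rewrite mem_cat vV.
by rewrite mem_cat vV orbT.
Qed.

Lemma local_set_indic V A : local_set V A -> local V (\1_A : config d q -> R).
Proof.
move=> AV s s' ss'; rewrite !indicE; congr (_%:R); congr nat_of_bool.
apply/idP/idP; rewrite !inE; first exact: AV.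
by apply: AV => v /ss'.
Qed.

Lemma measurable_local V A : local_set V A -> measurable A.
Proof.
elim: V A => [|v V IHV] A AV.
  have [->|/set0P[s As]] := eqVneq A set0; first exact: measurable0.
  have -> : A = setT; last exact: measurableT.
  by rewrite eqEsubset; split=> // s' _; exact: AV As.
have -> : A = \bigcup_(k in [set: spin q])
    ([set s | s v = k] `&` [set s | A (upd s v k)]).
  rewrite eqEsubset; split=> [s As|s [k _ [/= <-]]]; last by rewrite upd_id.
  by exists (s v) => //; split=> //=; rewrite upd_id.
apply: fin_bigcup_measurable => [|k _]; first exact: finite_finset.
apply: measurableI; first exact: measurable_spin_at.
apply: IHV => s s' ss'; apply: AV => w; rewrite inE /upd.
by case: (eqVneq w v) => //= _; exact: ss'.
Qed.

Definition simple_sum (r : seq (R * set (Omega d q))) (s : config d q) : R :=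
  \sum_(x <- r) x.1 * \1_(x.2) s.

(** Splitting according to one spin at a time, there are finitely many cases. Integrals of local
    functions thereby reduce to finite sums of measures of local sets. *)
Lemma local_simple V f : local V f -> (forall s, 0 <= f s) ->
  exists r : seq (R * set (Omega d q)), (forall x, x \in r -> 0 <= x.1 /\ local_set V x.2) /\ f = simple_sum r.
Proof.
elim: V f => [|v V IHV] f fV f0.
  exists [:: (f point, setT)]; split.
    by move=> x; rewrite mem_seq1 => /eqP -> /=; split.
  by apply: funext => s; rewrite /simple_sum big_seq1 indicT mulr1; exact: fV.
have fk k : local V (fun s => f (upd s v k)).
  move=> s s' ss'; apply: fV => w; rewrite inE /upd.
  by case: (eqVneq w v) => //= _; exact: ss'.
have /choice[r rP] k := IHV _ (fk k) (fun s => f0 _).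
pose r' k := [seq (x.1, [set s : Omega d q | s v = k] `&` x.2) | x <- r k].
exists (flatten [seq r' k | k <- enum {: spin q}]); split.
  move=> x /flatten_mapP[k _ /mapP[y yr ->]] /=; have [y0 yV] := (rP k).1 y yr.
  split=> // s s' ss' [/= sv ys]; split; first by rewrite /= -ss'// mem_head.
  by apply: yV ys => w wV; apply: ss'; rewrite inE wV orbT.
apply: funext => s; rewrite /simple_sum big_flatten big_map big_enum /=.
rewrite (bigD1 (s v))//= [X in _ + X]big1 ?addr0.
  rewrite /r' big_map -{1}[s](upd_id s v) -[LHS]/((fun t => f (upd t v (s v))) s).
  rewrite (rP (s v)).2; apply: eq_bigr => x _ /=; congr (_ * _).
  have sv : s \in ([set t | t v = s v] : set (Omega d q)) by rewrite inE.
  by rewrite !indicE in_setI sv.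
move=> k kv; rewrite /r' big_map big1// => x _ /=; rewrite indicE in_setI.
by rewrite memNset ?mulr0// => /= E; rewrite E eqxx in kv.
Qed.

Lemma local_measurable_fun V f : local V f -> measurable_fun setT (f : Omega d q -> R).
Proof.
move=> fV _ B mB; apply: (measurable_local V) => s s' ss' [_ Bs]; split=> //=.
by rewrite -(fV _ _ ss').
Qed.

Lemma local_measurable_EFin V f : local V f ->
  measurable_fun setT (EFin \o (f : Omega d q -> R)).
Proof. by move=> fV; apply/measurable_EFinP; exact: local_measurable_fun fV. Qed.

Section Integral.
Local Open Scope ereal_scope.
Variable nu : probability (Omega d q) R.

Lemma integral_simple_sum V r : (forall x, x \in r -> (0 <= x.1)%R /\ local_set V x.2) ->
  \int[nu]_s (simple_sum r s)%:E = \sum_(x <- r) x.1%:E * nu x.2.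
Proof.
elim: r => [|x r IHr] rV.
  rewrite big_nil; under eq_integral do rewrite /simple_sum big_nil.
  exact: integral0.
have [x0 xV] := rV x (mem_head _ _).
have rV' y : y \in r -> (0 <= y.1)%R /\ local_set V y.2.
  by move=> yr; apply: rV; rewrite inE yr orbT.
have mx := measurable_local _ _ xV.
have indV := local_set_indic _ _ xV.
have rE : simple_sum (x :: r) = (fun s => x.1 * \1_(x.2) s + simple_sum r s)%R.
  by apply: funext => s; rewrite /simple_sum big_cons.
have rsV : local V (simple_sum r).
  move=> s s' ss'; rewrite /simple_sum big_seq [RHS]big_seq; apply: eq_bigr => y yr.
  by have [_ yV] := rV' y yr; rewrite (local_set_indic _ _ yV _ _ ss').
rewrite big_cons -IHr// rE; under eq_integral do rewrite EFinD.
rewrite ge0_integralD//.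
- congr (_ + _); under eq_integral do rewrite EFinM.
  rewrite ge0_integralZl_EFin//.
  + by rewrite integral_indic// setIT.
  + exact: (local_measurable_EFin V).
- by move=> s _; rewrite lee_fin mulr_ge0.
- by apply: (local_measurable_EFin V) => s s' ss'; rewrite (indV _ _ ss').
- move=> s _; rewrite lee_fin /simple_sum big_seq sumr_ge0// => y yr.
  by rewrite mulr_ge0// (rV' y yr).1.
- exact: (local_measurable_EFin V).
Qed.

End Integral.

Lemma ge0_local_integral_le V f (nu mu : probability (Omega d q) R) (K : R) :
  0 <= K -> (forall A, measurable A -> (nu A <= K%:E * mu A)%E) ->
  local V f -> (forall s, 0 <= f s) ->
  (\int[nu]_s (f s)%:E <= K%:E * \int[mu]_s (f s)%:E)%E.
Proof.
move=> K0 numu fV f0; have [r [rV ->]] := local_simple V f fV f0.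
rewrite !(integral_simple_sum _ V)// big_seq [X in (_ * X)%E]big_seq.
rewrite ge0_sume_distrr; last by move=> x xr; rewrite mule_ge0// lee_fin (rV x xr).1.
rewrite lee_sum// => x xr; have [x0 xV] := rV x xr.
rewrite muleCA lee_wpmul2l ?lee_fin//; apply: numu; exact: (measurable_local V).
Qed.

End LocalFunctions.

(** * Realizing a positive functional as a probability on configurations *)

Section RestrictedPushforward.
Context {d1 d2 : measure_display} {T1 : measurableType d1} {T2 : measurableType d2}
  {R : realType}.
Variables (m : {measure set T1 -> \bar R}) (D : set T1) (f : T1 -> T2).
Hypotheses (mD : measurable D) (mf : measurable_fun setT f) (m1 : m D = 1%E).

(** Serves with [m] the Lebesgue measure, which is infinite, and [D] the unit interval, whose mass
    is 1. *)
Definition push_restr (A : set T2) := m (f @^-1` A `&` D).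

Let mpre A : measurable A -> measurable (f @^-1` A `&` D).
Proof. by move=> mA; apply: measurableI => //; rewrite -[X in measurable X]setTI; exact: mf. Qed.

Let push_restr0 : push_restr set0 = 0%E.
Proof. by rewrite /push_restr preimage_set0 set0I measure0. Qed.

Let push_restr_ge0 A : (0 <= push_restr A)%E.
Proof. exact: measure_ge0. Qed.

Let push_restr_sigma_additive : semi_sigma_additive push_restr.
Proof.
move=> F mF tF mUF; rewrite /push_restr preimage_bigcup setI_bigcupl.
apply: measure_semi_sigma_additive.
- by move=> n; exact: mpre.
- apply/trivIsetP => /= i j _ _ ij; rewrite setIACA -preimage_setI.
  by move/trivIsetP : tF => /(_ _ _ _ _ ij) ->//; rewrite preimage_set0 set0I.
- by rewrite -setI_bigcupl -preimage_bigcup; exact: mpre.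
Qed.

HB.instance Definition _ := isMeasure.Build _ _ _
  push_restr push_restr0 push_restr_ge0 push_restr_sigma_additive.

Let push_restr_setT : push_restr setT = 1%E.
Proof. by rewrite /push_restr preimage_setT setTI m1. Qed.

HB.instance Definition _ := Measure_isProbability.Build _ _ _ push_restr push_restr_setT.

Lemma push_restr_probability :
  exists P : probability T2 R, forall A, P A = m (f @^-1` A `&` D).
Proof. by exists push_restr. Qed.

End RestrictedPushforward.

(* Words are stored last letter first; [cell e] is the subinterval of [0, 1[,
   of length [p e], of the points whose code starts with the word [e]. *)
Section Coding.
Context {R : realType} {K : finType}.
Variables (k0 : K) (p : seq K -> R).
Hypotheses (p_ge0 : forall e, 0 <= p e) (p_nil : p [::] = 1)
  (p_cons : forall e, p e = \sum_k p (k :: e)).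

Definition cdf e (m : nat) := \sum_(k | (enum_rank k < m)%N) p (k :: e).

Fixpoint left_end e := if e is k :: e' then left_end e' + cdf e' (enum_rank k) else 0.

Definition in_cell e (t : R) := left_end e <= t < left_end e + p e.

(** The default [k0] is taken exactly when [t] is outside [cell e], as the cells of the one-letter
    extensions of [e] partition [cell e]. *)
Definition next e t := odflt k0 [pick k | in_cell (k :: e) t].

Fixpoint code n t := if n is n'.+1 then next (code n' t) t :: code n' t else [::].

Lemma cdfS e k : cdf e (enum_rank k).+1 = cdf e (enum_rank k) + p (k :: e).
Proof.
rewrite /cdf (bigD1 k)//= addrC; congr (_ + _); apply: eq_bigl => l.
by rewrite ltnS [RHS]ltn_neqAle andbC (inj_eq val_inj) (inj_eq enum_rank_inj).
Qed.

Lemma cdf_le e m n : (m <= n)%N -> cdf e m <= cdf e n.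
Proof.
move=> mn; rewrite /cdf [leRHS](bigID (fun k => (enum_rank k < m)%N))/=.
rewrite [X in X + _](eq_bigl (fun k => (enum_rank k < m)%N)).
  by rewrite lerDl sumr_ge0.
by move=> k; rewrite andb_idl// => /leq_trans; apply.
Qed.

Lemma cdf_total e : cdf e #|K| = p e.
Proof. by rewrite p_cons; apply: eq_bigl => k; rewrite ltn_ord. Qed.

Lemma in_cell_child e t : in_cell e t -> exists k, in_cell (k :: e) t.
Proof.
move=> /andP[et te]; pose P m := t < left_end e + cdf e m.
have exP : exists m, P m by exists #|K|; rewrite /P cdf_total.
(* The child sought is the first one whose right end lies beyond [t]; the minimum cannot be 0, since
   [cdf e 0 = 0]. *)
case: (ex_minnP exP) => -[|m] Pm min.
  by move: Pm; rewrite /P /cdf big1 ?addr0 ?ltNge ?et// => k.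
have mK : (m < #|K|)%N by apply: min; rewrite /P cdf_total.
exists (enum_val (Ordinal mK)).
rewrite /in_cell /= -addrA -cdfS enum_valK/= -/(P m.+1) Pm andbT leNgt.
by apply/negP => /min; rewrite ltnn.
Qed.

Lemma in_cell_parent k e t : in_cell (k :: e) t -> in_cell e t.
Proof.
rewrite /in_cell /= -addrA -cdfS => /andP[lt tr]; apply/andP; split.
  by apply: le_trans lt; rewrite lerDl sumr_ge0.
by apply: lt_le_trans tr _; rewrite lerD2l -cdf_total cdf_le.
Qed.

Lemma in_cell_inj k l e t : in_cell (k :: e) t -> in_cell (l :: e) t -> k = l.
Proof.
wlog kl : k l / (enum_rank k < enum_rank l)%N.
  move=> H; case: (ltngtP (enum_rank k) (enum_rank l)) => [|lk ? ?|/val_inj/enum_rank_inj//].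
    exact: H.
  by apply/esym; exact: H.
rewrite /in_cell /= -!addrA -!cdfS => /andP[_ tk] /andP[lt _].
have := lt_le_trans tk (le_trans _ lt); rewrite lerD2l cdf_le// => /(_ isT).
by rewrite ltxx.
Qed.

Lemma size_code n t : size (code n t) = n.
Proof. by elim: n => //= n ->. Qed.

Lemma in_cell_nil t : in_cell [::] t = (0 <= t < 1).
Proof. by rewrite /in_cell /= p_nil add0r. Qed.

Lemma next_in_cell e t : in_cell e t -> in_cell (next e t :: e) t.
Proof.
move=> /in_cell_child[k kt]; rewrite /next; case: pickP => //= /(_ k).
by rewrite kt.
Qed.

Lemma code_in_cell n t : 0 <= t < 1 -> in_cell (code n t) t.
Proof.
move=> t01; elim: n => [|n IHn]; first by rewrite in_cell_nil.
exact: next_in_cell.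
Qed.

Lemma in_cell_code e t : in_cell e t -> code (size e) t = e.
Proof.
elim: e => //= k e IHe kt; have et := in_cell_parent _ _ _ kt.
rewrite IHe//; congr cons; apply: in_cell_inj kt; exact: next_in_cell.
Qed.

Definition cell e : set R := [set t | in_cell e t].

Lemma cell_itv e : cell e = `[left_end e, left_end e + p e[%classic.
Proof. by apply/seteqP; split => t /=; rewrite in_itv. Qed.

Lemma measurable_cell e : measurable (cell e : set (measurableTypeR R)).
Proof. by rewrite cell_itv; exact: measurable_itv. Qed.

Lemma lebesgue_cell e : lebesgue_measure (cell e) = (p e)%:E.
Proof.
rewrite cell_itv lebesgue_measure_itv /= lte_fin ltrDl lt_neqAle p_ge0 andbT.
case: eqVneq => [<-//|_ /=]; by rewrite -EFinB addrAC subrr add0r.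
Qed.

Lemma cells_cons e (r : seq (seq K)) :
  [set t : R | exists2 e', e' \in e :: r & in_cell e' t] =
  cell e `|` [set t | exists2 e', e' \in r & in_cell e' t].
Proof.
apply/seteqP; split=> t /=.
  by move=> [e']; rewrite inE => /orP[/eqP ->|? ?]; [left|right; exists e'].
by move=> [?|[e' e'r ?]]; [exists e|exists e']; rewrite // inE ?eqxx ?e'r ?orbT.
Qed.

Lemma measurable_cells (r : seq (seq K)) :
  measurable ([set t | exists2 e, e \in r & in_cell e t] : set (measurableTypeR R)).
Proof.
elim: r => [|e r IHr]; first by rewrite (_ : mkset _ = set0)// -subset0 => t [].
rewrite cells_cons; apply: measurableU => //; exact: measurable_cell.
Qed.

(** Cells of words of equal length are disjoint, since [code] recovers the word from any point of
    its cell. *)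
Lemma lebesgue_cells (r : seq (seq K)) n : uniq r -> (forall e, e \in r -> size e = n) ->
  lebesgue_measure [set t : R | exists2 e, e \in r & in_cell e t] = (\sum_(e <- r) p e)%:E.
Proof.
elim: r => [|e r IHr] /=.
  by move=> _ _; rewrite big_nil (_ : mkset _ = set0) ?measure0// -subset0 => t [].
move=> /andP[er ur] rn.
have rn' e' : e' \in r -> size e' = n by move=> e'r; apply: rn; rewrite inE e'r orbT.
rewrite cells_cons measureU//; last 3 first.
- exact: measurable_cell.
- exact: measurable_cells.
- rewrite -subset0 => t [et [e' e'r e't]]; move: er.
  rewrite -(in_cell_code _ _ et) (rn e (mem_head _ _)) -(rn' e' e'r) in_cell_code//.
  by rewrite e'r.
by rewrite big_cons EFinD -(IHr ur rn') -lebesgue_cell.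
Qed.

End Coding.

Section StateMeasure.
Context {R : realType} {d q : nat}.
Variable w : (config d q -> R) -> R.

Definition bounded_obs (f : config d q -> R) := exists F, forall s, `|f s| <= F.

Hypotheses
  (wD : forall f g, bounded_obs f -> bounded_obs g -> w (fun s => f s + g s) = w f + w g)
  (wZ : forall x f, bounded_obs f -> w (fun s => x * f s) = x * w f)
  (w_ge0 : forall f, bounded_obs f -> (forall s, 0 <= f s) -> 0 <= w f)
  (w1 : w (fun=> 1) = 1).

Let bounded_nat (b : config d q -> bool) : bounded_obs (fun s => (b s)%:R).
Proof. by exists 1 => s; rewrite ger0_norm ?lern1 ?leq_b1. Qed.

Let w0 : w (fun=> 0) = 0.
Proof.
transitivity (w (fun s => 0 * 1)); first by congr w; apply: funext => s; rewrite mul0r.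
by rewrite wZ ?mul0r//; exists 1 => s; rewrite normr1.
Qed.

Let bounded_sum (I : Type) (r : seq I) (f : I -> config d q -> R) :
  (forall i, bounded_obs (f i)) -> bounded_obs (fun s => \sum_(i <- r) f i s).
Proof.
move=> fb; elim: r => [|i r [F IHr]]; first by exists 0 => s; rewrite big_nil normr0.
have [G GB] := fb i; exists (G + F) => s; rewrite big_cons.
by rewrite (le_trans (ler_normD _ _))// lerD.
Qed.

Let w_sum (I : Type) (r : seq I) (f : I -> config d q -> R) :
  (forall i, bounded_obs (f i)) ->
  w (fun s => \sum_(i <- r) f i s) = \sum_(i <- r) w (f i).
Proof.
move=> fb; elim: r => [|i r IHr].
  by rewrite big_nil -[RHS]w0; congr w; apply: funext => s; rewrite big_nil.
rewrite big_cons -IHr -wD//; last exact: bounded_sum.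
by congr w; apply: funext => s; rewrite big_cons.
Qed.

(* [pickle] enumerates the vertices with gaps; a gap is coded by a dummy spin. *)
Definition spin_nr n (s : config d q) : spin q := if pickle_inv n is Some v then s v else point.

Fixpoint word n s : seq (spin q) := if n is n'.+1 then spin_nr n' s :: word n' s else [::].

Definition unword (e : seq (spin q)) : config d q := fun v => nth point (rev e) (pickle v).

Definition word_weight (e : seq (spin q)) := w (fun s => (word (size e) s == e)%:R).

Lemma size_word n s : size (word n s) = n.
Proof. by elim: n => //= n ->. Qed.

Lemma unword_word n s v : (pickle v < n)%N -> unword (word n s) v = s v.
Proof.
elim: n => // n IHn; rewrite ltnS leq_eqVlt /unword /= rev_cons nth_rcons size_rev size_word.
case: ltngtP => //= [vn _|<- _]; first exact: IHn.
by rewrite /spin_nr pickleK_inv.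
Qed.

Lemma word_weight_ge0 e : 0 <= word_weight e.
Proof. by apply: w_ge0. Qed.

Lemma word_weight_nil : word_weight [::] = 1.
Proof. by rewrite -w1; congr w. Qed.

Lemma word_weight_cons e : word_weight e = \sum_k word_weight (k :: e).
Proof.
rewrite /word_weight -w_sum//; congr w; apply: funext => s /=.
rewrite (bigD1 (spin_nr (size e) s))//= eqseq_cons eqxx /= big1 ?addr0// => k.
by rewrite eqseq_cons eq_sym => /negbTE ->.
Qed.

Let codes := code (point : spin q) word_weight.

(** The letter number [pickle v] of the infinite code of [t], so that no truncation length has to be
    chosen; [unword_codes] relates it to the finite codes. *)
Definition decode (t : R) : config d q :=
  fun v => next (point : spin q) word_weight (codes (pickle v) t) t.

Lemma unword_codes n t v : (pickle v < n)%N -> unword (codes n t) v = decode t v.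
Proof.
elim: n => // n IHn; rewrite ltnS leq_eqVlt /unword /= rev_cons nth_rcons size_rev size_code.
case: ltngtP => //= [vn _|<- _] //; exact: IHn.
Qed.

(** Makes the decoding constant off the unit interval, so that it is measurable on the whole
    line. *)
Let clip (t : R) := if 0 <= t < 1 then t else 0.

Let D : set (measurableTypeR R) := [set t | 0 <= t < 1].

Let mD : measurable D.
Proof.
rewrite (_ : D = `[0, 1[%classic); first exact: measurable_itv.
by apply/seteqP; split => t /=; rewrite in_itv.
Qed.

Let in_cells n (P : set (seq (spin q))) : set (measurableTypeR R) :=
  [set t | exists2 e, e \in [seq val x | x <- enum {: n.-tuple (spin q)} & (val x) \in P]
    & in_cell word_weight e t].

Let in_cellsE n P : in_cells n P = [set t | 0 <= t < 1 /\ P (codes n t)].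
Proof.
apply/seteqP; split=> t /=.
  move=> [e /mapP[x]]; rewrite mem_filter => /andP[/set_mem Px _] -> et.
  have t01 : 0 <= t < 1.
    rewrite -(in_cell_nil word_weight word_weight_nil).
    elim: (val x) et => // k e' IH et; apply: IH.
    exact: (in_cell_parent _ word_weight_ge0 word_weight_cons _ _ _ et).
  split=> //; have := in_cell_code (point : spin q) _ word_weight_ge0 word_weight_cons _ _ et.
  by rewrite size_tuple /codes => ->.
move=> [t01 Pt]; exists (codes n t); last first.
  exact: (code_in_cell (point : spin q) _ word_weight_nil word_weight_cons _ _ t01).
have sz : size (codes n t) == n by rewrite size_code.
apply/mapP; exists (Tuple sz) => //; rewrite mem_filter mem_enum andbT.
exact: mem_set.
Qed.

Let lebesgue_in_cells n P : lebesgue_measure (in_cells n P) =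
  (w (fun s => (word n s \in P)%:R))%:E.
Proof.
rewrite (lebesgue_cells (point : spin q) _ word_weight_ge0 word_weight_cons _ n); last 2 first.
- by rewrite map_inj_uniq ?filter_uniq -?enumT ?enum_uniq// => x y xy; exact: val_inj.
- by move=> e /mapP[x _ ->]; rewrite size_tuple.
congr EFin; rewrite big_map big_filter big_enum_cond /=.
rewrite (eq_bigr (fun x : n.-tuple (spin q) => w (fun s => (word n s == val x)%:R))); last first.
  by move=> x _; rewrite /word_weight size_tuple.
rewrite big_mkcond /= (eq_bigr (fun x : n.-tuple (spin q) =>
    w (fun s => ((val x \in P) && (word n s == val x))%:R))); last first.
  by move=> x _; case: ifP.
rewrite -w_sum//; congr w; apply: funext => s.
have sz : size (word n s) == n by rewrite size_word.
rewrite (bigD1 (Tuple sz))//= eqxx andbT big1 ?addr0// => x /eqP xs.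
case: eqP => [E|]; last by rewrite andbF.
by case: xs; apply: val_inj; rewrite /= E.
Qed.

Let decode_clip (t : R) : Omega d q := decode (clip t).

Let measurable_decode_clip :
  measurable_fun (setT : set (measurableTypeR R)) decode_clip.
Proof.
apply: (@measurability _ _ _ _ setT decode_clip (cylinders d q)) => //.
move=> _ [_ [v [k ->]] <-]; rewrite setTI.
(* In a code of length [(pickle v).+1] the letter belonging to [v] is the last one, which is stored
   at the head. *)
pose n := (pickle v).+1; pose P := [set e : seq (spin q) | ohead e = Some k].
rewrite (_ : _ @^-1` _ = in_cells n P `|` (~` D `&` [set t | decode 0 v = k])).
  apply: measurableU.
    exact: measurable_cells.
  apply: measurableI; first exact: measurableC.
  have [E|E] := pselect (decode 0 v = k).
    by rewrite (_ : mkset _ = setT)//; apply/seteqP; split.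
  by rewrite (_ : mkset _ = set0)//; apply/seteqP; split.
rewrite in_cellsE; apply/seteqP; split=> t /=; rewrite /decode_clip /clip.
  case: ifP => t01 tk; [left|right].
    by split=> //; rewrite /P /= -tk.
  by split=> //; rewrite /D /= t01.
case=> [[-> [<-]]//|[/negP/negbTE -> ->]//].
Qed.

(** A local set depends on finitely many letters, so its preimage is a finite union of cells whose
    total length is the value of [w]. The functional [w] is only finitely additive; countable
    additivity is inherited from Lebesgue measure. *)
Lemma exists_state : exists mu : probability (Omega d q) R,
  forall V A, local_set V A -> mu A = (w \1_A)%:E.
Proof.
have D1 : lebesgue_measure D = 1%E.
  rewrite -w1.
  transitivity (lebesgue_measure (in_cells 0 setT)).
    by congr lebesgue_measure; rewrite in_cellsE; apply/seteqP; split => t //= [].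
  by rewrite lebesgue_in_cells; congr (w _)%:E; apply: funext => s; rewrite mem_set.
have [mu muE] := push_restr_probability lebesgue_measure D decode_clip mD
  measurable_decode_clip D1.
exists mu => V A AV.
have [n Vn] : exists n, forall v, v \in V -> (pickle v < n)%N.
  exists (\max_(v <- V) pickle v).+1 => v vV; rewrite ltnS (leq_bigmax_seq _ vV)//.
rewrite muE (_ : _ `&` _ = in_cells n [set e | A (unword e)]); last first.
  rewrite in_cellsE; apply/seteqP; split=> t /=.
    rewrite /decode_clip /clip => -[+ tD]; rewrite tD => At; split=> //.
    by apply: AV At => v /Vn vn; rewrite -(unword_codes n).
  move=> [t01 At]; split=> //; rewrite /decode_clip /clip t01.
  by apply: AV At => v /Vn vn; rewrite -(unword_codes n).
apply: (etrans (lebesgue_in_cells n _)); congr (w _)%:E.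
apply: funext => s; rewrite indicE.
congr (_%:R); congr nat_of_bool; apply/idP/idP; rewrite !inE /=; apply: AV => v /Vn vn.
  by rewrite unword_word.
by rewrite unword_word.
Qed.

Lemma integral_state (mu : probability (Omega d q) R) :
  (forall V A, local_set V A -> mu A = (w \1_A)%:E) ->
  forall V f, local V f -> (forall s, 0 <= f s) ->
  (\int[mu]_s (f s)%:E = (w f)%:E)%E.
Proof.
move=> muE V f fV f0; have [r [rV ->]] := local_simple V f fV f0.
rewrite (integral_simple_sum _ V)//.
have ind_b (A : set (Omega d q)) : bounded_obs \1_A.
  by exists 1 => s; rewrite indicE ger0_norm ?lern1 ?leq_b1.
have : w (simple_sum r) = \sum_(x <- r) x.1 * w \1_(x.2).
  rewrite /simple_sum w_sum; last first.
    move=> x; have [F FB] := ind_b x.2; exists (`|x.1| * F) => s.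
    by rewrite normrM ler_wpM2l.
  by apply: eq_bigr => x _; exact: wZ.
move=> ->; rewrite -sumEFin big_seq [RHS]big_seq; apply: eq_bigr => x xr.
by rewrite (muE V) ?EFinM//; exact: (rV x xr).2.
Qed.

End StateMeasure.

(** * The specification as a kernel, and the DLR equations *)

Section GibbsKernel.
Context {R : realType} {d q : nat}.
Variables (beta : R) (u : spin q -> spin q -> R) (or : vert d -> bool).

Definition weight (v : vert d) (k l : spin q) : R :=
  expR (- (beta * (if or v then u k l else u l k))).

Lemma weight_gt0 v k l : 0 < weight v k l.
Proof. exact: expR_gt0. Qed.

Lemma boltzE (L : seq (vert d)) tau eta :
  boltz beta u or L tau eta = wprod weight (edges_meeting L) (Defs.glue L eta tau).
Proof.
rewrite /boltz /hamiltonian mulr_sumr -sumrN.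
rewrite /wprod; elim: (edges_meeting L) => [|v E IHE]; first by rewrite !big_nil expR0.
by rewrite !big_cons expRD IHE.
Qed.

Lemma gammaE (L : seq (vert d)) (A : set (config d q)) tau : uniq L ->
  gamma beta u or L A tau = gam weight L \1_A tau.
Proof.
move=> uL; by rewrite /gamma /gam -!ssum_glue//; congr (_ / _); apply: eq_bigr => eta _; rewrite boltzE.
Qed.

End GibbsKernel.

Section LocalGibbs.
Context {R : realType} {d q : nat}.
Variables (a : vert d -> spin q -> spin q -> R).
Hypothesis a_gt0 : forall w k l, 0 < a w k l.
Implicit Types (L V : seq (vert d)) (A : set (Omega d q)).

Definition dlr L (mu : probability (Omega d q) R) A :=
  mu A = (\int[mu]_tau (gam a L (\1_A : config d q -> R) tau)%:E)%E.

Let gam_ge0 L A s : 0 <= gam a L (\1_A : config d q -> R) s.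
Proof.
have ind01 (t : config d q) : 0 <= (\1_A t : R) <= 1 by rewrite indicE ler0n lern1 leq_b1.
by have /andP[] := gam_bounds a a_gt0 L _ _ _ ind01 s.
Qed.

Lemma measurable_upd v k :
  measurable_fun setT ((fun s => upd s v k) : Omega d q -> Omega d q).
Proof.
apply: (@measurability _ _ (Omega d q) (Omega d q) setT (fun s => upd s v k)
  (cylinders d q)) => // _ [_ [w [l ->]] <-].
rewrite setTI; apply: (measurable_local [:: w]) => s s' ss' /=.
by rewrite /upd ss' ?mem_seq1.
Qed.

Lemma measurable_ssum L (f : Omega d q -> R) :
  measurable_fun setT f -> measurable_fun setT (ssum L f : Omega d q -> R).
Proof.
move=> mf; elim: L => //= v L IHL; apply: measurable_sum => k.
exact: measurableT_comp IHL (measurable_upd v k).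
Qed.

Lemma measurable_gam L (f : Omega d q -> R) :
  measurable_fun setT f -> measurable_fun setT (gam a L f : Omega d q -> R).
Proof.
move=> mf; have EL := local_wprod a (edges_meeting L).
apply: measurable_funM.
  apply: measurable_ssum; apply: measurable_funM => //.
  exact: local_measurable_fun EL.
apply: (local_measurable_fun (edges_meeting L ++ map (parent d) (edges_meeting L))).
by move=> s s' ss'; congr (_^-1); exact: local_ssum EL _ _ ss'.
Qed.

Let measurable_gam_EFin L A : measurable A ->
  measurable_fun setT (EFin \o (gam a L (\1_A : config d q -> R) : Omega d q -> R)).
Proof.
move=> mA; apply/measurable_EFinP; apply: measurable_gam.
exact: (@measurable_indic _ (Omega d q) R setT A).
Qed.

(** Only finitely many configurations enter the sum at a given [s], so eventual equality at each
    point passes through it. *)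
Lemma near_ssum L (f : nat -> config d q -> R) g :
  (forall s, \forall n \near \oo, f n s = g s) ->
  forall s, \forall n \near \oo, ssum L (f n) s = ssum L g s.
Proof.
move=> fg; elim: L => //= v L IHL s.
have : \forall n \near \oo, forall k, ssum L (f n) (upd s v k) = ssum L g (upd s v k).
  by apply: filter_forall => k; exact: IHL.
by apply: filterS => n H; apply: eq_bigr => k _; exact: H.
Qed.

Lemma local_sets_setI_closed : setI_closed [set A : set (Omega d q) | exists V, local_set V A].
Proof. by move=> A B [V AV] [V' BV']; exists (V ++ V'); exact: local_setI. Qed.

Lemma local_sets_generate :
  @measurable _ (Omega d q) `<=` <<s [set A : set (Omega d q) | exists V, local_set V A] >>.
Proof.
apply: smallest_sub; first exact: smallest_sigma_algebra.
move=> _ [v [k ->]]; apply: sub_sigma_algebra; exists [:: v] => s s' ss' /= <-.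
by rewrite ss' ?mem_seq1.
Qed.

(** Local sets are stable under intersection and generate, and the sets satisfying the equation form
    a lambda-system. For an increasing union the kernels are eventually constant at each
    configuration, by [near_ssum], so monotone convergence applies. *)
Lemma dlr_of_local L (mu : probability (Omega d q) R) :
  (forall V A, local_set V A -> dlr L mu A) -> forall A, measurable A -> dlr L mu A.
Proof.
move=> loc; pose G := [set A : set (Omega d q) | exists V, local_set V A].
pose H := [set A : set (Omega d q) | measurable A /\ dlr L mu A].
have GH : G `<=` H.
  by move=> A [V AV]; split; [exact: measurable_local AV|exact: loc AV].
suff HL : lambda_system setT H.
  by move=> A /local_sets_generate AG; have [] := lambda_system_subset local_sets_setI_closed HL GH (fun _ _ _ _ => I) AG.
split=> //.
- by apply: GH; exists [::] => s s' _ _.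
- move=> B A AB [mB dB] [mA dA].
  have mBA : measurable (B `\` A) by exact: measurableD.
  have E : mu (B `\` A) = (mu B - mu A)%E.
    rewrite measureD// ?(setIidr AB)//.
    by rewrite (le_lt_trans (probability_le1 mu mB)) ?ltry.
  split=> //; rewrite /dlr E dB dA.
  have -> : (\int[mu]_tau (gam a L (\1_B : config d q -> R) tau)%:E =
      \int[mu]_tau (gam a L (\1_(B `\` A) : config d q -> R) tau)%:E +
      \int[mu]_tau (gam a L (\1_A : config d q -> R) tau)%:E)%E.
    rewrite -ge0_integralD//; last 4 first.
    + by move=> s _; rewrite lee_fin.
    + exact: measurable_gam_EFin.
    + by move=> s _; rewrite lee_fin.
    + exact: measurable_gam_EFin.
    apply: eq_integral => s _; rewrite -EFinD; congr EFin.
    rewrite -[RHS](congr1 (@^~ s) (gamD a L _ _)); congr (gam _ _ _ _).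
    apply: funext => t; rewrite !indicE in_setD; case: (boolP (t \in A)) => tA.
      by rewrite andbF add0r; move: tA; rewrite !inE => /AB; rewrite -in_setE => ->.
    by rewrite andbT addr0.
  rewrite addeK//; rewrite -dA fin_num_measure//.
- move=> F ndF HF; have mF n := (HF n).1; have mU : measurable (\bigcup_n F n).
    exact: bigcupT_measurable.
  split=> //; rewrite /dlr.
  have c1 : mu (F n) @[n --> \oo] --> mu (\bigcup_n F n) by exact: nondecreasing_cvg_mu.
  pose g n (s : Omega d q) := (gam a L (\1_(F n) : config d q -> R) s)%:E.
  have ndg (s : Omega d q) : [set: Omega d q] s ->
      {homo g^~ s : n m / (n <= m)%N >-> (n <= m)%E}.
    move=> _ n m nm; rewrite lee_fin; apply: gam_le => // t; rewrite !indicE ler_nat.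
    have /subsetPset sub := ndF _ _ nm.
    case: (boolP (t \in F n)) => // tn; rewrite lt0b.
    by rewrite inE; apply: sub; rewrite inE in tn.
  have := cvg_monotone_convergence measurableT (mu := mu) (g' := g)
    (fun n => measurable_gam_EFin L _ (mF n)) (fun n s _ => gam_ge0 L (F n) s) ndg.
  have -> : (\int[mu]_(x in setT) limn (g^~ x) =
      \int[mu]_tau (gam a L (\1_(\bigcup_n F n) : config d q -> R) tau)%:E)%E.
    apply: eq_integral => s _; apply/cvg_lim => //; apply: cvg_near_cst.
    have ev t : \forall n \near \oo, (\1_(F n) t * wprod a (edges_meeting L) t : R) =
        \1_(\bigcup_n F n) t * wprod a (edges_meeting L) t.
      have [[m _ Fm]|nF] := pselect ((\bigcup_n F n) t).
        exists m => // n /= mn; congr (_ * _); rewrite !indicE !mem_set//; first by exists m.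
        by have /subsetPset := ndF _ _ mn; apply.
      apply: nearW => n; congr (_ * _); rewrite !indicE !memNset// => Fn.
      by apply: nF; exists n.
    by apply: filterS (near_ssum L _ _ ev s) => n; rewrite /g /gam => ->.
  move=> c2; apply: (cvg_unique _ c1) => //.
  by have -> : (fun n => mu (F n)) = (fun n => \int[mu]_(x in setT) g n x)%E
    by apply: funext => n; exact: (HF n).2.
Qed.

End LocalGibbs.

(** * Finite-volume means and their limits *)

Section FiniteVolumeMean.
Context {R : realType} {d q : nat}.
Variables (a : vert d -> spin q -> spin q -> R) (w0 : config d q).
Hypothesis a_gt0 : forall w k l, 0 < a w k l.
Implicit Types (f g : config d q -> R).

Definition mean M f := root_sum a w0 M f / root_sum a w0 M (fun=> 1).

Lemma root_sum1_gt0 M : 0 < root_sum a w0 M (fun=> 1).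
Proof.
rewrite root_sum_ssum; apply: ssum_gt0 => s; rewrite mul1r; exact: wprod_gt0.
Qed.

Lemma meanD M f g : mean M (fun s => f s + g s) = mean M f + mean M g.
Proof.
rewrite /mean -mulrDl !root_sum_ssum -[X in _ = X / _](congr1 (@^~ w0) (ssumD _ _ _)).
by congr (ssum _ _ _ / _); apply: funext => s; rewrite mulrDl.
Qed.

Lemma meanZ M x f : mean M (fun s => x * f s) = x * mean M f.
Proof.
rewrite /mean mulrA !root_sum_ssum -[X in _ = X / _](congr1 (@^~ w0) (ssumZ _ _ _)).
by congr (ssum _ _ _ / _); apply: funext => s; rewrite mulrA.
Qed.

Lemma mean1 M : mean M (fun=> 1) = 1.
Proof. by rewrite /mean divff// gt_eqF// root_sum1_gt0. Qed.

Lemma mean_le M f g : (forall s, f s <= g s) -> mean M f <= mean M g.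
Proof.
move=> fg; apply: ler_wpM2r; first by rewrite invr_ge0 ltW// root_sum1_gt0.
rewrite !root_sum_ssum; apply: le_ssum => s; rewrite ler_wpM2r// ltW//.
exact: wprod_gt0.
Qed.

Lemma mean_cst M x : mean M (fun=> x) = x.
Proof.
by have := meanZ M x (fun=> 1); rewrite mean1 mulr1.
Qed.

Lemma mean_norm M f F : (forall s, `|f s| <= F) -> `|mean M f| <= F.
Proof.
move=> fF; rewrite ler_norml -(mean_cst M (- F)) -{2}(mean_cst M F).
by apply/andP; split; apply: mean_le => s; have := fF s; rewrite ler_norml => /andP[].
Qed.

(* An ultrafilter replaces the extraction of a convergent subsequence. *)
Lemma mean_limit : exists (U : set_system nat) (w : (config d q -> R) -> R),
  [/\ UltraFilter U, \oo `<=` U &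
    forall f, bounded_obs f -> (fun M => mean M f) @ U --> w f].
Proof.
have [U [UU ooU]] := ultraFilterLemma (F := \oo) _.
have : forall f, exists l : R, bounded_obs f -> (fun M => mean M f) @ U --> l.
  move=> f; have [[F fF]|nb] := pselect (bounded_obs f); last by exists 0.
  have UF : UltraFilter ((fun M => mean M f) @ U).
    split; first exact: fmap_proper_filter.
    move=> G GF UG; apply/seteqP; split=> // A GA.
    have [//|UnA] := in_ultra_setVsetC ((fun M => mean M f) @^-1` A) UU.
    have : G (A `&` ~` A) by apply: filterI => //; exact: UG.
    by rewrite setICr => /filter_not_empty.
  have : ((fun M => mean M f) @ U) `[(- F), F]%classic.
    by apply: nearW => M /=; rewrite in_itv /= -ler_norml; exact: mean_norm.
  have := @segment_compact R (- F) F; rewrite compact_ultra => /(_ _ UF) H /H.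
  by move=> [l [_ lim]]; exists l.
move=> /choice[w wP]; exists U, w; split=> //.
Qed.

End FiniteVolumeMean.

Section LimitState.
Context {R : realType} {d q : nat}.
Variables (a : vert d -> spin q -> spin q -> R) (w0 : config d q).
Hypothesis a_gt0 : forall w k l, 0 < a w k l.
Implicit Types (f g : config d q -> R) (V : seq (vert d)).
Variables (U : set_system nat) (w : (config d q -> R) -> R).
Hypotheses (UU : UltraFilter U) (ooU : \oo `<=` U)
  (wlim : forall f, bounded_obs f -> (fun M => mean a w0 M f) @ U --> w f).

Let bounded_add f g : bounded_obs f -> bounded_obs g -> bounded_obs (fun s => f s + g s).
Proof.
by move=> [F fF] [G gG]; exists (F + G) => s; rewrite (le_trans (ler_normD _ _))// lerD.
Qed.

Let bounded_scale x f : bounded_obs f -> bounded_obs (fun s => x * f s).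
Proof. by move=> [F fF]; exists (`|x| * F) => s; rewrite normrM ler_wpM2l. Qed.

Let bounded_cst (x : R) : bounded_obs (fun _ : config d q => x).
Proof. by exists `|x|. Qed.

Lemma limitD f g : bounded_obs f -> bounded_obs g -> w (fun s => f s + g s) = w f + w g.
Proof.
move=> fb gb; apply: (cvg_unique _ (wlim _ (bounded_add _ _ fb gb))) => //.
have -> : (fun M => mean a w0 M (fun s => f s + g s)) =
    (fun M => mean a w0 M f) + (fun M => mean a w0 M g).
  by apply: funext => M; exact: meanD.
by apply: cvgD; exact: wlim.
Qed.

Lemma limitZ x f : bounded_obs f -> w (fun s => x * f s) = x * w f.
Proof.
move=> fb; apply: (cvg_unique _ (wlim _ (bounded_scale x _ fb))) => //.
have -> : (fun M => mean a w0 M (fun s => x * f s)) =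
    (fun=> x) \* (fun M => mean a w0 M f).
  by apply: funext => M; exact: meanZ.
by apply: cvgM; [exact: cvg_cst|exact: wlim].
Qed.

Lemma limit1 : w (fun=> 1) = 1.
Proof.
apply: (cvg_unique _ (wlim _ (bounded_cst 1))) => //.
by apply: cvg_near_cst; apply: nearW => M; exact: mean1.
Qed.

Lemma limit_ge0 f : bounded_obs f -> (forall s, 0 <= f s) -> 0 <= w f.
Proof.
move=> fb f0; apply: (cvgr_to_ge (wlim _ fb)); apply: nearW => M.
by rewrite -(mean_cst a w0 a_gt0 M 0); exact: mean_le.
Qed.

(** For all large [M] the ball of radius [M] contains [L], and [root_sum_gam] makes the two means
    equal. *)
Lemma limit_gam L f : uniq L -> bounded_obs f -> w (gam a L f) = w f.
Proof.
move=> uL fb; have [F fF] := fb.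
have gb : bounded_obs (gam a L f).
  exists F => s; rewrite ler_norml; apply: gam_bounds => // t.
  by rewrite -ler_norml.
apply: (cvg_unique _ (wlim _ gb)) => //.
suff: \forall M \near U, mean a w0 M f = mean a w0 M (gam a L f).
  by move=> fg; apply: cvg_trans (wlim _ fb); apply: near_eq_cvg.
apply: ooU; exists (\max_(v <- L) size (val v)) => // M /= LM.
rewrite /mean root_sum_gam// => v vL; apply: leq_trans LM.
by rewrite (leq_bigmax_seq _ vL).
Qed.

Lemma limit_le f x : bounded_obs f -> (\forall M \near \oo, mean a w0 M f <= x) -> w f <= x.
Proof. by move=> fb fx; apply: (cvgr_to_le (wlim _ fb)); exact: ooU. Qed.

Lemma limit_decorrelation f g x : bounded_obs f -> bounded_obs g ->
  bounded_obs (fun s => f s * g s) ->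
  (forall M, `|mean a w0 M (fun s => f s * g s) - mean a w0 M f * mean a w0 M g| <= x) ->
  `|w (fun s => f s * g s) - w f * w g| <= x.
Proof.
move=> fb gb fgb fgx.
have H : (fun M => `|mean a w0 M (fun s => f s * g s) - mean a w0 M f * mean a w0 M g|) @ U
    --> `|w (fun s => f s * g s) - w f * w g|.
  by apply: cvg_norm; apply: cvgB; [exact: wlim|apply: cvgM; exact: wlim].
by apply: (cvgr_to_le H); apply: nearW.
Qed.

(** The interaction has finite range, so the kernel maps local functions to local functions. On a
    local set the integral in the DLR equation is then a value of [w], and the equation is
    [limit_gam]. *)
Lemma exists_gibbs_state : exists mu : probability (Omega d q) R,
  [/\ forall V A, local_set V A -> mu A = (w \1_A)%:E,
      forall V f, local V f -> (forall s, 0 <= f s) ->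
        (\int[mu]_s (f s)%:E = (w f)%:E)%E &
      forall L, uniq L -> forall A, measurable A -> dlr a L mu A].
Proof.
have [mu muE] := exists_state w limitD limitZ limit_ge0 limit1.
have muI := integral_state w limitD limitZ mu muE.
exists mu; split=> // L uL; apply: dlr_of_local => // V A AV.
rewrite /dlr (muI (V ++ edges_meeting L ++ map (parent d) (edges_meeting L))).
- rewrite limit_gam//; first exact: (muE V).
  by exists 1 => s; rewrite indicE ger0_norm ?lern1 ?leq_b1.
- by apply: local_gam; exact: local_set_indic.
- move=> s; have ind01 (t : config d q) : 0 <= (\1_A t : R) <= 1.
    by rewrite indicE ler0n lern1 leq_b1.
  by have /andP[] := gam_bounds a a_gt0 L _ _ _ ind01 s.
Qed.

End LimitState.

(** * From decorrelation to extremality *)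

Section Extremality.
Context {R : realType} {d q : nat}.
Variables (a : vert d -> spin q -> spin q -> R) (w : (config d q -> R) -> R).
Hypothesis a_gt0 : forall w k l, 0 < a w k l.
Hypotheses
  (wD : forall f g, bounded_obs f -> bounded_obs g -> w (fun s => f s + g s) = w f + w g)
  (wZ : forall x f, bounded_obs f -> w (fun s => x * f s) = x * w f)
  (w_ge0 : forall f, bounded_obs f -> (forall s, 0 <= f s) -> 0 <= w f)
  (w1 : w (fun=> 1) = 1)
  (w_gam : forall L f, uniq L -> bounded_obs f -> w (gam a L f) = w f).
Hypothesis decorrelation : forall V (A : set (Omega d q)), local_set V A ->
  forall e, 0 < e -> exists N, forall h V', local V' h -> (forall s, `|h s| <= 1) ->
    sum_lt N.+1 h -> `|w (fun s => \1_A s * h s) - w \1_A * w h| <= e.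
Variable mu : probability (Omega d q) R.
Hypotheses
  (mu_local : forall V A, local_set V A -> mu A = (w \1_A)%:E)
  (mu_int : forall V f, local V f -> (forall s, 0 <= f s) ->
        (\int[mu]_s (f s)%:E = (w f)%:E)%E).

(* Conditionally on the spins outside a large ball, [mu] barely changes on
   local events; this passes to any Gibbs measure dominated by [mu]. *)
Lemma dominated_gibbs_local (nu : probability (Omega d q) R) (K : R) :
  0 <= K -> (forall A, measurable A -> (nu A <= K%:E * mu A)%E) ->
  (forall L, uniq L -> forall A, measurable A -> dlr a L nu A) ->
  forall V A, local_set V A -> nu A = mu A.
Proof.
move=> K0 numu nuG V A AV.
have mA := measurable_local _ _ AV; have AV' := local_set_indic (R := R) _ _ AV.
pose c := w \1_A; have muA : mu A = c%:E by exact: (mu_local V).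
have nuA : nu A = (fine (nu A))%:E by rewrite fineK// fin_num_measure.
rewrite nuA muA; congr EFin; apply/eqP; rewrite -subr_eq0 -normr_le0.
apply/ler_addgt0Pl => e e0; rewrite addr0.
(* The denominator is [K + 1] because [K] may be 0. *)
have eK : 0 < e / (K + 1) by rewrite divr_gt0// ltr_wpDl.
have [N decN] := decorrelation V A AV _ eK.
pose L := ball N : seq (vert d).
pose V' := V ++ edges_meeting L ++ map (parent d) (edges_meeting L).
pose g := gam a L (\1_A : config d q -> R).
have gV' : local V' g by exact: local_gam.
have ind01 (s : config d q) : 0 <= (\1_A s : R) <= 1.
  by rewrite indicE ler0n lern1 leq_b1.
have g01 s : 0 <= g s <= 1 by exact: gam_bounds.
(* The sign of [g - c], so that [|g - c| = h * (g - c)]. It ignores the spins of the ball, hence is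
   a far observable and commutes with the kernel: [w] gives [h * g] and [h * \1_A] the same value,
   and decorrelation bounds [w |g - c|]. *)
pose h s : R := if c <= g s then 1 else -1.
have hV' : local V' h by move=> s s' ss'; rewrite /h (gV' _ _ ss').
have h1 s : `|h s| <= 1 by rewrite /h; case: ifP => _; rewrite ?normrN normr1.
have hN : sum_lt N.+1 h.
  move=> v vN s k; rewrite /h /g gam_indep//.
  by rewrite mem_ball.
have ind_b : bounded_obs (\1_A : config d q -> R).
  by exists 1 => s; have /andP[? ?] := ind01 s; rewrite ger0_norm.
have hb : bounded_obs h by exists 1.
have indh_b : bounded_obs (fun s => h s * \1_A s).
  exists 1 => s; rewrite normrM mulr_ile1//.
  by have /andP[? ?] := ind01 s; rewrite ger0_norm.
have gh_b : bounded_obs (fun s => h s * g s).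
  exists 1 => s; rewrite normrM mulr_ile1//.
  by have /andP[? ?] := g01 s; rewrite ger0_norm.
have hL v : v \in L -> indep v h by move=> vL; apply: hN; rewrite ltnS -mem_ball.
have w_abs : w (fun s => `|g s - c|) <= e / (K + 1).
  have -> : (fun s => `|g s - c|) = (fun s => h s * g s + - c * h s).
    apply: funext => s; rewrite /h; case: leP => cg.
      by rewrite ger0_norm ?subr_ge0//; ring.
    by rewrite ltr0_norm ?subr_lt0//; ring.
  rewrite wD//; last by exists (`|- c| * 1) => s; rewrite normrM ler_wpM2l.
  rewrite wZ// -(gam_pull a L h _ hL) w_gam ?uniq_svol//.
  have := decN h V' hV' h1 hN.
  have -> : (fun s => \1_A s * h s) = (fun s => h s * \1_A s).
    by apply: funext => s; rewrite mulrC.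
  by rewrite -/c => /(le_trans (ler_norm _)); rewrite mulNr.
have abs_V' : local V' (fun s => `|g s - c|) by move=> s s' ss'; rewrite (gV' _ _ ss').
have nu_abs : (\int[nu]_s (`|g s - c|)%:E <= e%:E)%E.
  apply: (le_trans (ge0_local_integral_le V' _ nu mu K K0 numu abs_V' (fun s => normr_ge0 _))).
  rewrite (mu_int V')// -EFinM lee_fin (le_trans (ler_wpM2l K0 w_abs))//.
  rewrite mulrA ler_pdivrMr ?ltr_wpDl// mulrC ler_wpM2l ?(ltW e0)// lerDl//.
have nu_g : (\int[nu]_s (g s)%:E = (fine (nu A))%:E)%E.
  by rewrite -nuA; apply/esym; apply: nuG => //; exact: uniq_svol.
have c0 : 0 <= c by apply: w_ge0 => // s; have /andP[] := ind01 s.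
have mg := local_measurable_EFin V' g gV'.
have mabs := local_measurable_EFin V' _ abs_V'.
have int_c : (\int[nu]_s c%:E = c%:E)%E.
  transitivity (c%:E * nu setT)%E; first exact: integral_cst.
  by rewrite probability_setT mule1.
rewrite distrC ler_norml; apply/andP; split.
  rewrite lerNl opprB lerBlDr -lee_fin -nu_g.
  rewrite (@le_trans _ _ (\int[nu]_s ((`|g s - c|)%:E + c%:E))%E)//.
    apply: ge0_le_integral => //.
    + by move=> s _; have /andP[] := g01 s.
    + by apply: emeasurable_funD.
    + by move=> s _; rewrite -EFinD lee_fin -lerBlDr ler_norm.
  rewrite ge0_integralD//; last 1 first.
    by rewrite EFinD int_c leeD2r.
rewrite lerBlDr -lee_fin -{1}int_c.
rewrite (@le_trans _ _ (\int[nu]_s ((`|g s - c|)%:E + (g s)%:E))%E)//.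
  apply: ge0_le_integral => //.
  + by apply: emeasurable_funD.
  + move=> s _; rewrite -EFinD lee_fin -lerBlDr distrC; exact: ler_norm.
rewrite ge0_integralD//.
  by rewrite EFinD nu_g leeD2r.
by move=> s _; have /andP[] := g01 s.
Qed.

Lemma dominated_gibbs_unique (nu : probability (Omega d q) R) (K : R) :
  0 <= K -> (forall A, measurable A -> (nu A <= K%:E * mu A)%E) ->
  (forall L, uniq L -> forall A, measurable A -> dlr a L nu A) ->
  forall A, measurable A -> nu A = mu A.
Proof.
move=> K0 numu nuG A mA; pose G := [set A : set (Omega d q) | exists V, local_set V A].
apply: (g_sigma_algebra_measure_unique G _ (fun=> setT)) => //.
- by move=> B [V BV]; exact: measurable_local BV.
- by move=> _; exists [::].
- by rewrite bigcup_const.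
- exact: local_sets_setI_closed.
- by move=> B [V BV]; exact: (dominated_gibbs_local nu K K0 numu nuG V).
- by move=> _; rewrite (le_lt_trans (probability_le1 nu measurableT))// ltry.
- exact: local_sets_generate.
Qed.

End Extremality.

(** * The estimates for Boltzmann weights *)

Section Potts.
Context {R : realType} {d q dmax : nat} {umin Umax beta : R}.
Variables (u : spin q -> spin q -> R) (or : vert d -> bool).
Let Q : R := #|{: spin q}|%:R.
Let dl : R := (d%:R - 1) * umin - dmax%:R * (Umax + umin).
Let x := expR (- (beta * umin)).
Let y := expR (- (beta * Umax)).
Let z := expR (- (dl * beta)).
Let a := weight beta u or.
Hypotheses (u_ge0 : forall k l, 0 <= u k l) (u_diag : forall k, u k k = 0)
  (u_min : is_offdiag_min u umin) (u_max : is_max_entry u Umax)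
  (dmax_le : (dmax <= d)%N) (beta_ge0 : 0 <= beta)
  (Qz_le : d.+1%:R * (1 + Q) * (Q ^+ d.+1 * z) <= 2^-1).

Let umin_ge0 : 0 <= umin. Proof. by have [_ [k [l [_ <-]]]] := u_min. Qed.

Let Umax_ge0 : 0 <= Umax. Proof. by have [_ [k [l <-]]] := u_max. Qed.

Let a_le1 v k l : a v k l <= 1.
Proof.
by rewrite -expR0 ler_expR oppr_le0; case: (or v); rewrite mulr_ge0.
Qed.

Let a_diag v k : a v k k = 1.
Proof. by rewrite /a /weight !u_diag if_same mulr0 oppr0 expR0. Qed.

Let a_off v k l : k != l -> a v k l <= x.
Proof.
move=> kl; rewrite ler_expR lerN2 ler_wpM2l//.
by case: (or v); apply: u_min.1; rewrite // eq_sym.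
Qed.

Let a_ge v k l : y <= a v k l.
Proof. by rewrite ler_expR lerN2 ler_wpM2l//; case: (or v); exact: u_max.1. Qed.

Let a_gt0 v k l : 0 < a v k l. Proof. exact: weight_gt0. Qed.

Let y_gt0 : 0 < y. Proof. exact: expR_gt0. Qed.
Let x_gt0 : 0 < x. Proof. exact: expR_gt0. Qed.
Let x_le1 : x <= 1. Proof. by rewrite -expR0 ler_expR oppr_le0 mulr_ge0. Qed.
Let z_ge0 : 0 <= z. Proof. exact: expR_ge0. Qed.

(** Equality holds at [b = dmax]; every broken edge fewer gains a factor
    [e^(-beta (Umax + umin))]. *)
Let peierls b : (b <= dmax)%N -> x ^+ (d - b) / y ^+ b <= z * x.
Proof.
move=> bd; rewrite /x /y -!expRM_natl -expRN -!expRD ler_expR.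
have bd' : (b <= d)%N by exact: leq_trans dmax_le.
rewrite natrB// -subr_ge0.
have -> : - (dl * beta) + - (beta * umin) -
    ((d%:R - b%:R) * - (beta * umin) + - (b%:R * - (beta * Umax))) =
    beta * ((dmax%:R - b%:R) * (Umax + umin)) by rewrite /dl; ring.
by rewrite mulr_ge0// mulr_ge0 ?subr_ge0 ?ler_nat// addr_ge0.
Qed.

Let Q_ge1 : 1 <= Q.
Proof. by rewrite ler1n; apply/card_gt0P; exists point. Qed.

Let Qz_ge0 : 0 <= Q ^+ d.+1 * z.
Proof. by rewrite mulr_ge0// exprn_ge0// ler0n. Qed.

Let Qz_le1 : Q ^+ d.+1 * z <= 1.
Proof.
apply: le_trans (le_trans Qz_le _); last by rewrite invf_le1 ?ler1n.
rewrite ler_peMl//; have : 1 <= d.+1%:R :> R by rewrite ler1n.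
by move: Q_ge1; nra.
Qed.

Let bounded_indic (A : set (Omega d q)) : bounded_obs (\1_A : config d q -> R).
Proof. by exists 1 => s; rewrite indicE ger0_norm ?lern1 ?leq_b1. Qed.

(** The Gibbs property is asserted for every [w0] and the rest only for ground states, so that a
    choice over all configurations gives the total family asked for in the theorem. *)
Lemma exists_potts_state (w0 : config d q) : exists mu : probability (Omega d q) R,
  is_gibbs beta u or mu /\ (ground_state d q dmax w0 ->
    is_extremal_gibbs beta u or mu /\
    forall v, ((1 - Q * (Q ^+ d.+1 * z))%:E <= mu [set s : Omega d q | s v = w0 v])%E).
Proof.
have [U [w [UU ooU wlim]]] := mean_limit a w0 a_gt0.
have [mu [mu_local mu_int mu_dlr]] := exists_gibbs_state a w0 a_gt0 U w UU ooU wlim.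
have wD := limitD a w0 U w UU wlim; have wZ := limitZ a w0 U w UU wlim.
exists mu; split=> [L uL A mA|ground].
  by rewrite (mu_dlr L uL A mA); apply: eq_integral => s _; rewrite gammaE.
have dlr_gibbs (nu : probability (Omega d q) R) : is_gibbs beta u or nu ->
    forall L, uniq L -> forall A, measurable A -> dlr a L nu A.
  by move=> nuG L uL A mA; rewrite /dlr (nuG L uL A mA); apply: eq_integral => s _; rewrite gammaE.
split; last first.
  move=> v; pose dev (s : config d q) : R := (s v != w0 v)%:R.
  have dev_b : bounded_obs dev by exists 1 => s; rewrite ger0_norm ?lern1 ?leq_b1.
  rewrite (mu_local [:: v]); last by move=> s s' ss' /= <-; rewrite ss' ?mem_seq1.
  (* The estimate bounds the deviation from above, so the event is written as the complement of a
     deviation and linearity of [w] is used. *)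
  have -> : \1_[set s : Omega d q | s v = w0 v] = (fun s => 1 + -1 * dev s).
    apply: funext => s; rewrite indicE /dev; case: eqVneq => [E|E].
      by rewrite mem_set// mulr0 addr0.
    by rewrite memNset ?mulr1 ?subrr//; apply/eqP.
  rewrite wD//; last 2 first.
  - by exists 1 => s; rewrite normr1.
  - have [F FB] := dev_b; exists (1 * F) => s; rewrite normrM normrN1 ler_wpM2l//.
  rewrite wZ// (limit1 a w0 a_gt0 U w UU wlim) lee_fin mulN1r lerD2l lerN2.
  apply: (limit_le a w0 U w UU ooU wlim) => //.
  exists (size (val v)) => // M /= vM; rewrite /mean ler_pdivrMr ?root_sum1_gt0//.
  exact: (root_sum_deviation a w0 x y z a_le1 a_diag a_off a_ge y_gt0 x_gt0 x_le1 z_ge0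
    dmax_le ground peierls Qz_le1).
have decor V (A : set (Omega d q)) : local_set V A ->
  forall e, 0 < e -> exists N, forall h V', local V' h -> (forall s, `|h s| <= 1) ->
    sum_lt N.+1 h -> `|w (fun s => \1_A s * h s) - w \1_A * w h| <= e.
  move=> AV e e0; pose L := (\max_(v <- V) size (val v))%N.
  pose K := d.+1%:R * (Q / y) ^+ d.+2.
  pose B := 2 * Q * (K ^+ L * 2).
  have Q0 : 0 <= Q by exact: ler0n.
  have K0 : 0 <= K.
    exact: mulr_ge0 (ler0n _ _) (exprn_ge0 _ (divr_ge0 Q0 (ltW y_gt0))).
  have B0 : 0 <= B.
    exact: mulr_ge0 (mulr_ge0 (ler0n _ 2) Q0) (mulr_ge0 (exprn_ge0 L K0) (ler0n _ 2)).
  (* With [th <= 1/2] the error is at most [B / 2 ^+ I], and [B / e < I < 2 ^+ I] brings it below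
     [e]. *)
  pose I := Num.bound (B / e); exists (L + I)%N => h V' _ h1 hN.
  have ind1 (s : config d q) : `|\1_A s : R| <= 1 by rewrite indicE ger0_norm ?lern1 ?leq_b1.
  have AL : sum_le L (\1_A : config d q -> R).
    move=> v vL; apply: (local_indep V); last exact: local_set_indic.
    by apply/negP => vV; move: vL; rewrite ltnNge (leq_bigmax_seq _ vV).
  have hN' : sum_lt (L + I) h by move=> v vN; apply: hN; exact: ltnW.
  apply: (limit_decorrelation a w0 U w UU wlim) => //.
  - by exists 1.
  - by exists 1 => s; rewrite normrM mulr_ile1.
  move=> M; have := root_sum_decorrelation a w0 x y z a_le1 a_diag a_off a_ge y_gt0 x_gt0
    x_le1 z_ge0 dmax_le ground peierls Qz_le1 M L I _ h 1 1 ind1 h1 AL hN'.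
  rewrite /mean; have := root_sum1_gt0 a w0 a_gt0 M.
  set r1 := root_sum _ _ _ (fun=> 1); set rf := root_sum _ _ _ \1_A.
  set rh := root_sum _ _ _ h; set rfh := root_sum _ _ _ _ => r10 H.
  have -> : rfh / r1 - rf / r1 * (rh / r1) = (rfh * r1 - rf * rh) / r1 ^+ 2.
    by field; rewrite gt_eqF.
  rewrite normrM [X in _ * X]ger0_norm ?invr_ge0 ?exprn_ge0 ?(ltW r10)//.
  rewrite ler_pdivrMr ?exprn_gt0// (le_trans H)// ler_wpM2r ?exprn_ge0 ?(ltW r10)//.
  rewrite !mulr1 -/Q -/K.
  set th := d.+1%:R * (1 + Q) * (Q ^+ d.+1 * z).
  have th0 : 0 <= th.
    exact: mulr_ge0 (mulr_ge0 (ler0n _ _) (addr_ge0 ler01 Q0)) Qz_ge0.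
  have -> : 2 * Q * (K ^+ L * (2 * th ^+ I)) = B * th ^+ I by rewrite /B; ring.
  have BI : B / e < I%:R by apply: archi_boundP; rewrite divr_ge0// ltW.
  have thI : th ^+ I <= (2 ^+ I)^-1.
    by rewrite -exprVn lerXn2r// nnegrE ?invr_ge0.
  rewrite (le_trans (ler_wpM2l B0 thI))// ler_pdivrMr ?exprn_gt0//.
  rewrite ltr_pdivrMr// in BI; rewrite (le_trans (ltW BI))// mulrC ler_wpM2l ?(ltW e0)//.
  by rewrite -natrX ler_nat ltnW// ltn_expl.
have w_ge0 := limit_ge0 a w0 a_gt0 U w UU wlim.
have w_gam L f := limit_gam a w0 a_gt0 U w UU ooU wlim L f.
have unique := dominated_gibbs_unique a w a_gt0 wD wZ w_ge0 w_gam decor mu mu_local mu_int.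
move=> t mu1 mu2 /andP[t0 t1] G1 G2 mix A mA.
have t1' : 0 < 1 - t by rewrite subr_gt0.
have tV : 0 <= t^-1 by rewrite invr_ge0 ltW.
have tV' : 0 <= (1 - t)^-1 by rewrite invr_ge0 ltW.
have D1 B : measurable B -> (mu1 B <= (t^-1)%:E * mu B)%E.
  move=> mB; rewrite (mix B mB).
  rewrite [leLHS](_ : _ = (t^-1)%:E * (t%:E * mu1 B))%E; last first.
    by rewrite muleA -EFinM mulVf ?mul1e// lt0r_neq0.
  by rewrite lee_wpmul2l ?lee_fin// leeDl// mule_ge0// lee_fin ltW.
have D2 B : measurable B -> (mu2 B <= ((1 - t)^-1)%:E * mu B)%E.
  move=> mB; rewrite (mix B mB).
  rewrite [leLHS](_ : _ = ((1 - t)^-1)%:E * ((1 - t)%:E * mu2 B))%E; last first.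
    by rewrite muleA -EFinM mulVf ?mul1e// lt0r_neq0.
  by rewrite lee_wpmul2l ?lee_fin// leeDr// mule_ge0// lee_fin ltW.
by rewrite (unique mu1 _ tV D1 (dlr_gibbs _ G1))// (unique mu2 _ tV' D2 (dlr_gibbs _ G2)).
Qed.

End Potts.

Theorem theorem2 (R : realType) (d q dmax : nat) (umin Umax : R) :
  (2 <= d)%N -> (2 <= q)%N -> (dmax <= d)%N ->
  dmax%:R * (Umax + umin) < (d%:R - 1) * umin ->
  exists beta0 c C : R, [/\ 0 < beta0, 0 < c, 0 < C &
    forall (u : spin q -> spin q -> R) (or : vert d -> bool),
      (forall k l, 0 <= u k l) -> (forall k, u k k = 0) ->
      is_offdiag_min u umin -> is_max_entry u Umax ->
      forall beta : R, beta0 <= beta ->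
      exists mu : config d q -> probability (Omega d q) R,
        (forall w0 t0 : config d q,
            ground_state d q dmax w0 -> ground_state d q dmax t0 -> w0 <> t0 ->
            exists A : set (Omega d q), measurable A /\ mu w0 A <> mu t0 A) /\
        (forall w0 : config d q, ground_state d q dmax w0 ->
          [/\ is_gibbs beta u or (mu w0),
              is_extremal_gibbs beta u or (mu w0) &
              forall v : vert d,
                ((1 - C * expR (- (c * beta)))%:E
                   <= mu w0 [set s : Omega d q | s v = w0 v])%E])].
Proof.
move=> _ _ dmax_le gap; pose Q : R := #|{: spin q}|%:R.
pose dl := (d%:R - 1) * umin - dmax%:R * (Umax + umin).
have dl0 : 0 < dl by rewrite subr_gt0.
have Q1 : 1 <= Q by rewrite ler1n; apply/card_gt0P; exists point.
have Q0 : 0 < Q by exact: lt_le_trans Q1.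
pose A0 := d.+1%:R * (1 + Q) * (Q * Q ^+ d.+1).
have C0 : 0 < Q * Q ^+ d.+1 by rewrite mulr_gt0// exprn_gt0.
have A00 : 0 < A0 by exact: mulr_gt0 (mulr_gt0 (ltr0Sn _ _) (addr_gt0 ltr01 Q0)) C0.
(* [C] and [c] are read off [root_sum_deviation], where [Z] is [Q ^+ d.+1 * z] with
   [z = e^(-dl beta)]. The bound on [beta] gives [e^(dl beta) >= 1 + dl beta >= 4 * A0], so
   [A0 * z <= 1/4]; [A0] dominates both [C] and the contraction constant, which therefore become
   small together. *)
exists (4 * A0 / dl), dl, (Q * Q ^+ d.+1); split=> //; first exact: divr_gt0 (mulr_gt0 (ltr0Sn _ _) A00) dl0.
move=> u or u_ge0 u_diag u_min u_max beta beta_ge.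
rewrite ler_pdivrMr// in beta_ge.
have beta0 : 0 <= beta by rewrite -(pmulr_lge0 _ dl0) (le_trans _ beta_ge)// mulr_ge0// ltW.
set z := expR (- (dl * beta)).
have z0 : 0 <= z by exact: expR_ge0.
have A0z : A0 * z <= 4^-1.
  rewrite /z expRN ler_pdivrMr ?expR_gt0// mulrC ler_pdivlMr// mulrC.
  rewrite (le_trans beta_ge)// mulrC (le_trans _ (expR_ge1Dx _))// lerDr ler01.
  by [].
have d1 : 1 <= d.+1%:R :> R by rewrite ler1n.
have Cz : Q * Q ^+ d.+1 * z <= 4^-1.
  apply: le_trans A0z; rewrite ler_wpM2r// ler_peMl ?(ltW C0)//.
  by move: Q1 d1; nra.
have Qz : d.+1%:R * (1 + Q) * (Q ^+ d.+1 * z) <= 2^-1.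
  apply: (@le_trans _ _ 4^-1); last by lra.
  apply: le_trans A0z; rewrite /A0 -!mulrA ler_wpM2l// ler_wpM2l ?addr_ge0 ?(ltW Q0)//.
  by rewrite ler_peMl// mulr_ge0// exprn_ge0// ltW.
have /choice[mu muP] := exists_potts_state u or u_ge0 u_diag u_min u_max dmax_le beta0 Qz.
exists mu; split=> [w0 t0 gw gt wt|w0 gw]; last first.
  have [G /(_ gw)[E D]] := muP w0; split=> // v; rewrite -mulrA; exact: D.
have [v wtv] : exists v, w0 v <> t0 v.
  apply: contrapT => /forallNP H; apply: wt; apply: funext => v.
  by apply: contrapT; exact: H.
have mS k := @measurable_spin_at d q v k.
(* By [Cz] this event has probability at least 3/4 under [mu w0], and at most 1/4 under [mu t0],
   which favours a different spin at [v]. *)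
exists [set s | s v = w0 v]; split=> // E.
have [_ /(_ gw)[_ /(_ v)]] := muP w0; have [_ /(_ gt)[_ /(_ v)]] := muP t0.
rewrite !mulrA -/z E => Dt Dw.
have : ((1 - Q * Q ^+ d.+1 * z)%:E <= 1 - (1 - Q * Q ^+ d.+1 * z)%:E)%E.
  apply: (le_trans Dw).
  have sub : [set s | s v = w0 v] `<=` ~` [set s : Omega d q | s v = t0 v].
    by move=> s /= -> /wtv.
  have le : (mu t0 [set s | s v = w0 v] <= mu t0 (~` [set s | s v = t0 v]))%E.
    by apply: le_measure => //; rewrite inE//; exact: measurableC.
  by apply: (le_trans le); rewrite probability_setC// leeB.
rewrite -EFinB lee_fin; move: Cz; lra.
Qed.
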